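(* Let $0<\alpha<1$. Then there is a constant $c>0$ such that for every $f\in(\Lambda_\alpha)_+$ and for arbitrary contractions $T$ and $R$ on Hilbert space the following inequality holds: $$\|f(T)-f(R)\|\le c\,\|f\|_{\Lambda_\alpha}\,\|T-R\|^\alpha .$$
   Context: Let $\mathbb T$ be the unit circle. For $0<\alpha<1$, $\Lambda_\alpha$ is the Hölder class of functions $f$ on $\mathbb T$ with $\|f\|_{\Lambda_\alpha}=\sup_{\zeta\ne\tau}|f(\zeta)-f(\tau)|/|\zeta-\tau|^\alpha<\infty$. $(\Lambda_\alpha)_+$ is the set of $f\in\Lambda_\alpha$ whose Fourier coefficients satisfy $\hat f(n)=0$ for $n<0$; such functions extend to functions in the disk algebra $C_A$ (functions continuous on the closed unit disk and analytic in its interior). A contraction is an operator of norm at most $1$. For a contraction $T$ and $f\in C_A$, $f(T)$ is defined by the extension of the polynomial functional calculus to $C_A$ by means of von Neumann's inequality $\|f(T)\|\le\|f\|_{C_A}$. *)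

(* Defs.v *)
From Stdlib Require Import Reals ZArith ClassicalEpsilon.
From Coquelicot Require Import Coquelicot.

Local Open Scope R_scope.

(* [Rpower 0 a] is 1, so the base 0 needs a separate value: [rpow 0 a = 0],
   the convention for a positive exponent [a]. *)
Definition rpow (x a : R) : R :=
  if Req_EM_T x 0 then 0 else Rpower x a.

(** Functions on the unit circle are given by maps [C -> C] of which only
    the values on the circle are used. *)

Definition on_circle (z : C) : Prop := Cmod z = 1.

Definition circle_point (t : R) : C := (cos t, sin t).

Definition holder_quotient (alpha : R) (f : C -> C) (q : R) : Prop :=
  exists z w : C, on_circle z /\ on_circle w /\ z <> w /\
    q = Cmod (f z - f w)%C / rpow (Cmod (z - w)%C) alpha.

Definition holder_norm (alpha : R) (f : C -> C) : Rbar :=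
  Lub_Rbar (holder_quotient alpha f).

Definition holder (alpha : R) (f : C -> C) : Prop :=
  Rbar_lt (holder_norm alpha f) p_infty.

Definition fourier (f : C -> C) (n : Z) : C :=
  (RtoC (/ (2 * PI)) *
   RInt (V := C_R_CompleteNormedModule)
     (fun t => f (circle_point t) * circle_point (- (IZR n * t)))%C
     0 (2 * PI))%C.

Definition holder_plus (alpha : R) (f : C -> C) : Prop :=
  holder alpha f /\ forall n : Z, (n < 0)%Z -> fourier f n = RtoC 0.

(* The extension to the closed unit disk of a continuous [f] on the circle
   with no negative Fourier coefficients: its Taylor coefficients at 0 are the
   Fourier coefficients of [f].  The values for [Cmod z > 1] are irrelevant. *)
Definition disk_extension (f : C -> C) (z : C) : C :=
  if Rlt_dec (Cmod z) 1 then
    iota (T := C_CompleteNormedModule)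
      (is_pseries (K := C_AbsRing) (V := C_NormedModule)
         (fun n => fourier f (Z.of_nat n)) z)
  else f z.

(** Complex Hilbert spaces; the inner product is linear in its first
    argument. *)

Record Hilbert : Type := {
  hilbert_space :> CompleteNormedModule C_AbsRing;
  inner : hilbert_space -> hilbert_space -> C;
  inner_plus_l : forall x y z : hilbert_space,
    inner (plus x y) z = (inner x z + inner y z)%C;
  inner_scal_l : forall (a : C) (x y : hilbert_space),
    inner (scal a x) y = (a * inner x y)%C;
  inner_conj : forall x y : hilbert_space, inner y x = Cconj (inner x y);
  inner_norm : forall x : hilbert_space, inner x x = RtoC (norm x ^ 2)
}.

Definition opnorm {H : Hilbert} (A : H -> H) : Rbar :=
  Lub_Rbar (fun r => exists x : H, norm x <= 1 /\ r = norm (A x)).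

Definition op_minus {H : Hilbert} (A B : H -> H) : H -> H :=
  fun x => minus (A x) (B x).

(* Coquelicot's [is_linear] includes boundedness. *)
Definition contraction {H : Hilbert} (T : H -> H) : Prop :=
  is_linear T /\ Rbar_le (opnorm T) 1.

(** The polynomial with coefficients [a 0], ..., [a N], at a complex number
    and at an operator. *)

Definition poly_eval (a : nat -> C) (N : nat) (z : C) : C :=
  sum_n (fun k => (a k * z ^ k)%C) N.

Definition poly_op {H : Hilbert} (a : nat -> C) (N : nat) (T : H -> H)
    : H -> H :=
  fun x => sum_n (fun k => scal (a k) (Nat.iter k T x)) N.

(* The bounded operator [A] is the limit in operator norm of [p(T)] as the
   polynomial [p] tends to [g] uniformly on the closed unit disk.  For [g] in
   the disk algebra and a contraction [T], von Neumann's inequality and the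
   density of the polynomials yield exactly one such [A]. *)
Definition is_disk_calculus {H : Hilbert} (g : C -> C) (T A : H -> H) : Prop :=
  is_linear A /\
  forall eps : R, 0 < eps -> exists delta : R, 0 < delta /\
    forall (a : nat -> C) (N : nat),
      (forall z : C, Cmod z <= 1 -> Cmod (poly_eval a N z - g z)%C <= delta) ->
      Rbar_le (opnorm (op_minus (poly_op a N T) A)) eps.

Definition disk_calculus {H : Hilbert} (g : C -> C) (T : H -> H) : H -> H :=
  epsilon (inhabits (fun _ : H => zero)) (is_disk_calculus g T).

(** [f(T)] for [f] given on the unit circle. *)
Definition apply_op {H : Hilbert} (f : C -> C) (T : H -> H) : H -> H :=
  disk_calculus (disk_extension f) T.

(* Main.v *)
(** Littlewood-Paley decomposition: [f] is approximated on the circle by polynomials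
    [P_j] of degree at most [2^j] with error [O(|f| 2^(-j alpha))].  By von Neumann's
    inequality [f(T)] is within the same error of [P_j(T)].  An operator Bernstein inequality
    bounds [p(T) - p(R)] by [deg p * sup |p| * |T - R|]; applied to [P_(j+1) - P_j] and summed
    up to the [J] with [2^J] of order [1 / |T - R|], it gives the estimate.

    Both operator inequalities come from the boundedness of the Toeplitz operator with
    symbol [p] on vector-valued sequences (Parseval).  For von Neumann's inequality it is
    applied to the orbit [T^l x], once with the norm and once with the semi-norm
    [sqrt (|u|^2 - |T u|^2)], which replaces the isometric dilation of [T]; for Bernstein's
    inequality the Horner partial sums of [p(R) x] form a Toeplitz product.  No adjoints are
    needed. *)

Require Import Defs.
From Stdlib Require Import Reals Lra Lia ZArith ClassicalEpsilon ssreflect.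
From Coquelicot Require Import Coquelicot.

Local Open Scope R_scope.

(** * Inner products and Parseval's identity *)

(** Summing over the orbit with the norm alone settles von Neumann's inequality only for isometries,
    where no norm is lost along the orbit. For a general contraction the defect form measures the
    loss, for [p(T) x] as well as for [x]; when both bounds are averaged over a long orbit, the
    unknown decay cancels and only [N] boundary terms remain.

    In the telescoped difference [p(T) - p(R)] each Horner partial result belongs to a truncation of
    [p], and truncation may raise the supremum by a logarithmic factor. Only the sum of squares of
    the partial results has a clean bound, hence the detour through Cauchy-Schwarz.

    Both [f(T)] and the values of [f] inside the disk are picked by choice operators, so each must
    be identified with a limit of polynomials. Multiplication by [z] on the one-dimensional space
    [C_hilbert] makes the scalar limit an instance of the operator limit; von Neumann's inequality
    there takes the place of the maximum principle. *)

Section InnerProduct.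
Context (H : Hilbert).
Implicit Types x y z : H.

Lemma inner_plus_r x y z : inner H z (plus x y) = (inner H z x + inner H z y)%C.
Proof.
rewrite inner_conj inner_plus_l Cplus_conj.
now rewrite -!inner_conj.
Qed.

Lemma inner_scal_r (a : C) x y : inner H x (scal a y) = (Cconj a * inner H x y)%C.
Proof.
rewrite inner_conj inner_scal_l Cmult_conj.
now rewrite -inner_conj.
Qed.

Lemma norm_sqr x : norm x ^ 2 = Re (inner H x x).
Proof. now rewrite inner_norm. Qed.

Lemma norm_plus_sqr x y :
  norm (plus x y) ^ 2 = norm x ^ 2 + 2 * Re (inner H x y) + norm y ^ 2.
Proof.
rewrite !norm_sqr inner_plus_l !inner_plus_r (inner_conj H x y).
unfold Re, Cconj; simpl; ring.
Qed.

Lemma norm_scal_sqr (a : C) x : norm (scal a x) ^ 2 = Cmod a ^ 2 * norm x ^ 2.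
Proof.
rewrite !norm_sqr inner_scal_l inner_scal_r inner_norm Cmod2_alt.
unfold Re, Im, Cconj; simpl; ring.
Qed.

Lemma norm_scal_Cmod (a : C) x : norm (scal a x) = Cmod a * norm x.
Proof.
apply Rsqr_inj.
- apply norm_ge_0.
- apply Rmult_le_pos; [apply Cmod_ge_0 | apply norm_ge_0].
- rewrite !Rsqr_pow2 norm_scal_sqr; ring.
Qed.

End InnerProduct.

Lemma circle_point_plus s t :
  circle_point (s + t) = (circle_point s * circle_point t)%C.
Proof.
apply injective_projections; simpl; [rewrite cos_plus | rewrite sin_plus]; ring.
Qed.

Lemma circle_point_conj t : Cconj (circle_point t) = circle_point (- t).
Proof. unfold circle_point, Cconj; simpl; now rewrite cos_neg sin_neg. Qed.

Lemma circle_point_pow t k : (circle_point t ^ k)%C = circle_point (INR k * t).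
Proof.
induction k as [|k IH].
- simpl; rewrite Rmult_0_l; unfold circle_point; now rewrite cos_0 sin_0.
- rewrite Cpow_S IH S_INR -circle_point_plus; f_equal; ring.
Qed.

Lemma Cmod_circle_point t : Cmod (circle_point t) = 1.
Proof.
unfold Cmod, circle_point; simpl.
replace (cos t * (cos t * 1) + sin t * (sin t * 1)) with 1.
- apply sqrt_1.
- generalize (sin2_cos2 t); unfold Rsqr; lra.
Qed.

Lemma sin_IZR_2PI n : sin (IZR n * (2 * PI)) = 0.
Proof. apply sin_eq_0_1; exists (2 * n)%Z; rewrite mult_IZR; ring. Qed.

Lemma cos_IZR_2PI n : cos (IZR n * (2 * PI)) = 1.
Proof.
replace (IZR n * (2 * PI)) with (2 * (IZR n * PI)) by ring.
rewrite cos_2a_sin (sin_eq_0_1 (IZR n * PI)); [ring | now exists n].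
Qed.

Lemma is_RInt_eq {V : NormedModule R_AbsRing} (f : R -> V) a b l l' :
  is_RInt f a b l -> l = l' -> is_RInt f a b l'.
Proof. now intros Hf <-. Qed.

Lemma is_RInt_cos (n : Z) : n <> 0%Z ->
  is_RInt (fun t => cos (IZR n * t)) 0 (2 * PI) 0.
Proof.
intros Hn; assert (Hn' : IZR n <> 0) by now apply not_0_IZR.
eapply is_RInt_eq.
- apply (is_RInt_derive (fun t => sin (IZR n * t) / IZR n)).
  + intros t _; auto_derive; [easy | now field].
  + intros t _; apply (ex_derive_continuous (fun t => cos (IZR n * t))); now auto_derive.
- rewrite sin_IZR_2PI Rmult_0_r sin_0; unfold minus, plus, opp; simpl; now field.
Qed.

Lemma is_RInt_sin (n : Z) : is_RInt (fun t => sin (IZR n * t)) 0 (2 * PI) 0.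
Proof.
destruct (Z.eq_dec n 0) as [-> | Hn].
- apply is_RInt_ext with (fun _ : R => 0).
  + intros t _; now rewrite Rmult_0_l sin_0.
  + apply (is_RInt_eq _ _ _ _ _ (is_RInt_const 0 (2 * PI) (0 : R))).
    apply Rmult_0_r.
- assert (Hn' : IZR n <> 0) by now apply not_0_IZR.
  eapply is_RInt_eq.
  + apply (is_RInt_derive (fun t => - cos (IZR n * t) / IZR n)).
    * intros t _; auto_derive; [easy | now field].
    * intros t _; apply (ex_derive_continuous (fun t => sin (IZR n * t))); now auto_derive.
  + rewrite cos_IZR_2PI Rmult_0_r cos_0; unfold minus, plus, opp; simpl; now field.
Qed.

Section Parseval.
Context (H : Hilbert).

(** Orthogonality of characters: every index [k <= m] differs from [n], so each term has mean zero.
    This is the cross term in [parseval]. *)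
Lemma is_RInt_inner_sum (h : nat -> H) (g : H) (m n : nat) : (m < n)%nat ->
  is_RInt (fun t => Re (inner H
      (sum_n (fun k => scal (circle_point t ^ k)%C (h k)) m)
      (scal (circle_point t ^ n)%C g))) 0 (2 * PI) 0.
Proof.
assert (Hterm : forall k, (k < n)%nat ->
  is_RInt (fun t => Re (inner H (scal (circle_point t ^ k)%C (h k))
      (scal (circle_point t ^ n)%C g))) 0 (2 * PI) 0).
{ intros k Hk.
  set (d := (Z.of_nat k - Z.of_nat n)%Z).
  (* The real part of [e^(idt) * inner (h k) g], where [d = k - n] is nonzero. *)
  apply is_RInt_ext with (fun t : R =>
    minus (scal (Re (inner H (h k) g)) (cos (IZR d * t)))
          (scal (Im (inner H (h k) g)) (sin (IZR d * t)))).
  - intros t _.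
    rewrite inner_scal_l inner_scal_r Cmult_assoc !circle_point_pow
      circle_point_conj -circle_point_plus.
    replace (INR k * t + - (INR n * t)) with (IZR d * t).
    + unfold minus, plus, opp, scal; simpl; unfold mult; simpl.
      unfold Re, Im; ring.
    + unfold d; rewrite minus_IZR -!INR_IZR_INZ; ring.
  - eapply is_RInt_eq.
    + apply @is_RInt_minus; apply @is_RInt_scal.
      * apply is_RInt_cos; unfold d; lia.
      * apply is_RInt_sin.
    + unfold minus, plus, opp, scal; simpl; unfold mult; simpl; ring. }
induction m as [|m IH]; intros Hm.
- apply is_RInt_ext with (2 := Hterm 0%nat Hm); intros t _; now rewrite sum_O.
- apply is_RInt_ext with (fun t : R => plus
    (Re (inner H (sum_n (fun k => scal (circle_point t ^ k)%C (h k)) m)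
      (scal (circle_point t ^ n)%C g)))
    (Re (inner H (scal (circle_point t ^ S m)%C (h (S m)))
      (scal (circle_point t ^ n)%C g)))).
  + intros t _; now rewrite sum_Sn (inner_plus_l H (sum_n _ m)).
  + eapply is_RInt_eq.
    * apply @is_RInt_plus; [apply IH; lia | now apply Hterm].
    * apply Rplus_0_r.
Qed.

Lemma parseval (h : nat -> H) (n : nat) :
  is_RInt (fun t => norm (sum_n (fun k => scal (circle_point t ^ k)%C (h k)) n) ^ 2)
    0 (2 * PI) (2 * PI * sum_n (fun k => norm (h k) ^ 2) n).
Proof.
assert (Hterm : forall t k, norm (scal (circle_point t ^ k)%C (h k)) ^ 2 = norm (h k) ^ 2).
{ intros t k; rewrite norm_scal_sqr Cmod_pow Cmod_circle_point pow1; ring. }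
assert (Hconst : forall k, is_RInt (fun t => norm (scal (circle_point t ^ k)%C (h k)) ^ 2)
   0 (2 * PI) (2 * PI * norm (h k) ^ 2)).
{ intros k; apply is_RInt_ext with (fun _ : R => norm (h k) ^ 2).
  - intros t _; now rewrite Hterm.
  - eapply is_RInt_eq.
    + apply @is_RInt_const.
    + unfold scal; simpl; unfold mult; simpl; ring. }
induction n as [|n IH].
- rewrite sum_O; apply is_RInt_ext with (2 := Hconst 0%nat); intros t _; now rewrite sum_O.
- apply is_RInt_ext with (fun t : R => plus (plus
    (norm (sum_n (fun k => scal (circle_point t ^ k)%C (h k)) n) ^ 2)
    (scal 2 (Re (inner H (sum_n (fun k => scal (circle_point t ^ k)%C (h k)) n)
                  (scal (circle_point t ^ S n)%C (h (S n)))))))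
    (norm (scal (circle_point t ^ S n)%C (h (S n))) ^ 2)).
  + intros t _; rewrite sum_Sn (norm_plus_sqr H (sum_n _ n)). reflexivity.
  + eapply is_RInt_eq.
    * apply @is_RInt_plus; [apply @is_RInt_plus; [exact IH | apply @is_RInt_scal] |].
      -- apply is_RInt_inner_sum; lia.
      -- apply Hconst.
    * rewrite sum_Sn; unfold plus, scal; simpl; unfold mult; simpl; ring.
Qed.

End Parseval.

(** * Toeplitz operators on vector-valued sequences *)

(** Lets translates of a finite sequence be summed over one common range. The guard [d <= m] is
    essential, because [m - d] is truncated subtraction. *)
Lemma sum_n_shift {G : AbelianMonoid} (g : nat -> G) (d L K : nat) : (d + L <= K)%nat ->
  sum_n (fun m => if ((d <=? m) && (m - d <=? L))%nat%bool then g (m - d)%nat else zero) K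
  = sum_n g L.
Proof.
intros HK.
enough (Hgen : forall K, sum_n (fun m =>
    if ((d <=? m) && (m - d <=? L))%nat%bool then g (m - d)%nat else zero) K
  = if (d <=? K)%nat then sum_n g (Nat.min (K - d) L) else zero).
{ rewrite Hgen; destruct (Nat.leb_spec d K); [f_equal; lia | lia]. }
clear K HK; induction K as [|K IH].
- rewrite sum_O; destruct d as [|d]; [|easy].
  simpl; now rewrite sum_O.
- rewrite sum_Sn IH.
  destruct (Nat.leb_spec d K), (Nat.leb_spec d (S K)); try lia; cbn [andb].
  + destruct (Nat.leb_spec (S K - d) L).
    * replace (Nat.min (S K - d) L) with (S (Nat.min (K - d) L)) by lia.
      rewrite sum_Sn; do 2 f_equal; lia.
    * rewrite plus_zero_r; f_equal; lia.
  + replace (Nat.min (S K - d) L) with 0%nat by lia; rewrite sum_O.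
    replace (S K - d)%nat with 0%nat by lia; apply plus_zero_l.
  + apply plus_zero_l.
Qed.

Lemma sum_n_scal_r {K : Ring} {V : ModuleSpace K} (u : nat -> K) (x : V) n :
  sum_n (fun k => scal (u k) x) n = scal (sum_n u n) x.
Proof.
induction n as [|n IH]; [now rewrite !sum_O|].
now rewrite !sum_Sn IH scal_distr_r.
Qed.

Lemma sum_n_le_R (u v : nat -> R) n :
  (forall k, (k <= n)%nat -> u k <= v k) -> sum_n u n <= sum_n v n.
Proof.
induction n as [|n IH]; intros Huv.
- rewrite !sum_O; apply Huv; lia.
- rewrite !sum_Sn; apply Rplus_le_compat; [apply IH; intros; apply Huv; lia | apply Huv; lia].
Qed.

Lemma sum_n_ge_0 (u : nat -> R) n : (forall k, 0 <= u k) -> 0 <= sum_n u n.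
Proof.
intros Hu; induction n as [|n IH]; [rewrite sum_O; apply Hu|].
rewrite sum_Sn; now apply Rplus_le_le_0_compat.
Qed.

Lemma sum_n_shift_le (u : nat -> R) (J N K : nat) : (forall k, 0 <= u k) ->
  (J + N <= K)%nat -> sum_n (fun j => u (j + N)%nat) J <= sum_n u K.
Proof.
intros Hu HK.
rewrite -(sum_n_shift (fun j => u (j + N)%nat) N J K) //; [|lia].
apply sum_n_le_R; intros k _.
destruct (Nat.leb_spec N k); cbn [andb]; [|apply Hu].
destruct (k - N <=? J)%nat; [|apply Hu].
rewrite Nat.sub_add //; apply Rle_refl.
Qed.

(** Positivity, homogeneity and Parseval are all that the bound uses of a quadratic form, so [Q] may
    degenerate, as the defect form does. *)
Section Toeplitz.
Context (H : Hilbert) (Q : H -> R).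
Hypothesis Q_pos : forall x, 0 <= Q x.
Hypothesis Q_scal : forall (a : C) x, Q (scal a x) = Cmod a ^ 2 * Q x.
Hypothesis Q_parseval : forall (h : nat -> H) n,
  is_RInt (fun t => Q (sum_n (fun k => scal (circle_point t ^ k)%C (h k)) n))
    0 (2 * PI) (2 * PI * sum_n (fun k => Q (h k)) n).

(** A product of generating functions: the symbol is [p] at the conjugate point, and the unimodular
    factor [e^N] clears the negative powers so that all indices are natural numbers. *)
Lemma toeplitz_product (a : nat -> C) (w : nat -> H) (N L : nat) (t : R) :
  sum_n (fun m => scal (circle_point t ^ m)%C (sum_n (fun k =>
    if ((N - k <=? m) && (m - (N - k) <=? L))%nat%bool
    then scal (a k) (w (m - (N - k))%nat) else zero) N)) (N + L)
  = scal (circle_point t ^ N * poly_eval a N (circle_point (- t)))%C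
      (sum_n (fun l => scal (circle_point t ^ l)%C (w l)) L).
Proof.
set (e := circle_point t).
transitivity (sum_n (fun m => sum_n (fun k =>
    if ((N - k <=? m) && (m - (N - k) <=? L))%nat%bool
    then scal (a k * e ^ (N - k))%C
           (scal (e ^ (m - (N - k)))%C (w (m - (N - k))%nat))
    else zero) N) (N + L)).
- apply sum_n_ext; intros m; rewrite -sum_n_scal_l.
  apply sum_n_ext; intros k.
  destruct (Nat.leb_spec (N - k) m); cbn [andb]; [|apply @scal_zero_r].
  destruct (m - (N - k) <=? L)%nat; [|apply @scal_zero_r].
  rewrite !scal_assoc; f_equal; unfold mult; simpl.
  replace m with ((N - k) + (m - (N - k)))%nat at 1 by lia.
  rewrite Cpow_add_r; ring.
- rewrite sum_n_switch.
  transitivity (sum_n (fun k => scal (a k * e ^ (N - k))%C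
      (sum_n (fun l => scal (e ^ l)%C (w l)) L)) N).
  + apply sum_n_ext; intros k.
    rewrite -sum_n_scal_l.
    apply (sum_n_shift (fun l => scal (a k * e ^ (N - k))%C (scal (e ^ l)%C (w l)))); lia.
  + rewrite (sum_n_scal_r (fun k => (a k * e ^ (N - k))%C)); f_equal.
    etransitivity; [|apply (sum_n_mult_l (K := C_Ring))].
    apply sum_n_ext_loc; intros k Hk.
    unfold mult; simpl.
    replace N with (k + (N - k))%nat at 2 by lia.
    assert (He : (e ^ k * circle_point (- t) ^ k = 1)%C).
    { rewrite -Cpow_mult_l /e -circle_point_plus Rplus_opp_r.
      unfold circle_point; rewrite cos_0 sin_0; apply Cpow_1_l. }
    rewrite Cpow_add_r.
    transitivity (a k * e ^ (N - k) * (e ^ k * circle_point (- t) ^ k))%C; [|ring].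
    rewrite He; ring.
Qed.

(** The sums on the left are some of the coefficients of the product; the others only add
    nonnegative terms. Parseval before and after multiplication by the symbol, which is at most [M]
    in modulus, gives the bound. *)
Lemma toeplitz_bound (a : nat -> C) (N : nat) (M : R) (w : nat -> H) (J : nat) :
  (forall t, Cmod (poly_eval a N (circle_point t)) <= M) ->
  sum_n (fun j => Q (sum_n (fun k => scal (a k) (w (j + k)%nat)) N)) J
    <= M ^ 2 * sum_n (fun l => Q (w l)) (J + N).
Proof.
intros Ha.
set (L := (J + N)%nat).
set (h := fun m => sum_n (fun k =>
    if ((N - k <=? m) && (m - (N - k) <=? L))%nat%bool
    then scal (a k) (w (m - (N - k))%nat) else zero) N).
apply Rle_trans with (sum_n (fun m => Q (h m)) (N + L)).
(* At index [j + N] with [j <= J] both guards hold for every [k], and the coefficient is the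
   complete sum over [a k * w (j + k)]. *)
- rewrite -(sum_n_ext_loc (fun j => Q (h (j + N)%nat))).
  + apply (sum_n_shift_le (fun m => Q (h m))); [intros; apply Q_pos | unfold L; lia].
  + intros j Hj; f_equal; unfold h; apply sum_n_ext_loc; intros k Hk.
    replace (N - k <=? j + N)%nat with true by (symmetry; apply Nat.leb_le; lia).
    replace (j + N - (N - k) <=? L)%nat with true
      by (symmetry; apply Nat.leb_le; unfold L; lia).
    cbn [andb]; do 2 f_equal; lia.
- apply Rmult_le_reg_l with (2 * PI); [generalize PI_RGT_0; lra|].
  apply (is_RInt_le
    (fun t => Q (sum_n (fun k => scal (circle_point t ^ k)%C (h k)) (N + L)))
    (fun t => scal (M ^ 2) (Q (sum_n (fun l => scal (circle_point t ^ l)%C (w l)) L)))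
    0 (2 * PI)).
  + generalize PI_RGT_0; lra.
  + apply Q_parseval.
  + eapply is_RInt_eq; [apply @is_RInt_scal, Q_parseval|].
    unfold scal; simpl; unfold mult; simpl; ring.
  + intros t _; unfold h; rewrite toeplitz_product Q_scal.
    apply Rmult_le_compat_r; [apply Q_pos|].
    rewrite Cmod_mult Cmod_pow Cmod_circle_point pow1 Rmult_1_l.
    apply pow_incr; split; [apply Cmod_ge_0 | apply Ha].
Qed.

End Toeplitz.

(** * Von Neumann's inequality *)

Section OperatorNorm.
Context {H : Hilbert}.
Implicit Types A B T : H -> H.

Lemma opnorm_le A c : 0 <= c -> (forall x, norm (A x) <= c * norm x) ->
  Rbar_le (opnorm A) c.
Proof.
intros Hc HA; unfold opnorm.
apply (proj2 (Lub_Rbar_correct _)).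
intros r [x [Hx ->]]; simpl.
apply Rle_trans with (1 := HA x).
rewrite -{2}(Rmult_1_r c); now apply Rmult_le_compat_l.
Qed.

Lemma opnorm_bound A c : (forall (k : C) x, A (scal k x) = scal k (A x)) ->
  Rbar_le (opnorm A) (Finite c) -> forall x, norm (A x) <= c * norm x.
Proof.
intros HA Hc x.
destruct (Req_dec (norm x) 0) as [Hx | Hx].
- assert (Hzero : A x = zero).
  { rewrite (norm_eq_zero x Hx).
    transitivity (A (scal (zero : C_AbsRing) zero)).
    - f_equal; symmetry; apply (scal_zero_r (V := H)).
    - rewrite HA; apply (scal_zero_l (V := H)). }
  rewrite Hzero norm_zero Hx; lra.
- assert (Hx0 : 0 < norm x) by (generalize (norm_ge_0 x); lra).
  assert (HC : Cmod (RtoC (/ norm x)) = / norm x).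
  { rewrite Cmod_R Rabs_pos_eq //; left; now apply Rinv_0_lt_compat. }
  assert (Hle : norm (A (scal (RtoC (/ norm x)) x)) <= c).
  { refine (Rbar_le_trans (Finite _) _ (Finite c) _ Hc).
    apply (proj1 (Lub_Rbar_correct _)).
    exists (scal (RtoC (/ norm x)) x); split; [|easy].
    rewrite norm_scal_Cmod HC; right; now field. }
  rewrite HA norm_scal_Cmod HC in Hle.
  apply Rmult_le_reg_l with (/ norm x); [now apply Rinv_0_lt_compat|].
  apply Rle_trans with (1 := Hle); right; now field.
Qed.

Lemma opnorm_ge_0 A : Rbar_le 0 (opnorm A).
Proof.
apply Rbar_le_trans with (norm (A zero)); [apply norm_ge_0|].
apply (proj1 (Lub_Rbar_correct _)).
exists zero; split; [rewrite norm_zero; lra | easy].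
Qed.

Lemma contraction_norm T x : contraction T -> norm (T x) <= norm x.
Proof.
intros [HT H1]; rewrite -[X in _ <= X]Rmult_1_l.
apply opnorm_bound; [apply (linear_scal _ HT) | exact H1].
Qed.

Lemma linear_sum_n A (u : nat -> H) n : is_linear A ->
  A (sum_n u n) = sum_n (fun k => A (u k)) n.
Proof.
intros HA; induction n as [|n IH]; [now rewrite !sum_O|].
now rewrite !sum_Sn (linear_plus _ HA) IH.
Qed.

Lemma linear_minus A x y : is_linear A -> A (minus x y) = minus (A x) (A y).
Proof.
intros HA; unfold minus.
now rewrite (linear_plus _ HA) -(scal_opp_one y) (linear_scal _ HA) scal_opp_one.
Qed.

(** Brings the orbit of [p(T) x] into the form bounded by [toeplitz_bound], with [w l = T^l x]. *)
Lemma iter_poly_op (a : nat -> C) N T x j : is_linear T ->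
  Nat.iter j T (poly_op a N T x)
  = sum_n (fun k => scal (a k) (Nat.iter (j + k) T x)) N.
Proof.
intros HT; induction j as [|j IH]; [easy|].
simpl; rewrite IH linear_sum_n //.
apply sum_n_ext; intros k; apply (linear_scal _ HT).
Qed.

(** [T] passes through the trigonometric sum, so this is Parseval for [h] minus Parseval for
    [T h]. *)
Lemma is_RInt_parseval_defect T (h : nat -> H) n : is_linear T ->
  is_RInt (fun t => norm (sum_n (fun k => scal (circle_point t ^ k)%C (h k)) n) ^ 2
      - norm (T (sum_n (fun k => scal (circle_point t ^ k)%C (h k)) n)) ^ 2)
    0 (2 * PI) (2 * PI * sum_n (fun k => norm (h k) ^ 2 - norm (T (h k)) ^ 2) n).
Proof.
intros HT.
apply is_RInt_ext with (fun t => minus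
   (norm (sum_n (fun k => scal (circle_point t ^ k)%C (h k)) n) ^ 2)
   (norm (sum_n (fun k => scal (circle_point t ^ k)%C (T (h k))) n) ^ 2)).
- intros t _; rewrite linear_sum_n //; unfold minus, plus, opp; simpl.
  unfold Rminus; do 4 f_equal.
  + apply sum_n_ext; intros k; symmetry; apply (linear_scal _ HT).
  + f_equal; apply sum_n_ext; intros k; symmetry; apply (linear_scal _ HT).
- eapply is_RInt_eq; [apply @is_RInt_minus; apply parseval|].
  induction n as [|n IH].
  + rewrite !sum_O; unfold minus, plus, opp; simpl; ring.
  + rewrite !sum_Sn; revert IH; unfold minus, plus, opp; simpl; lra.
Qed.

End OperatorNorm.

Section VonNeumann.
Context {H : Hilbert} (T : H -> H).
Hypothesis T_contraction : contraction T.

Lemma iter_contraction_norm x k : norm (Nat.iter k T x) <= norm x.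
Proof.
induction k as [|k IH]; simpl; [lra|].
now apply Rle_trans with (1 := contraction_norm T _ T_contraction).
Qed.

Lemma iter_norm_sqr_le x k : norm (Nat.iter k T x) ^ 2 <= norm x ^ 2.
Proof. apply pow_incr; split; [apply norm_ge_0 | apply iter_contraction_norm]. Qed.

Lemma defect_sum x n :
  sum_n (fun j => norm (Nat.iter j T x) ^ 2 - norm (T (Nat.iter j T x)) ^ 2) n
  = norm x ^ 2 - norm (Nat.iter (S n) T x) ^ 2.
Proof.
induction n as [|n IH]; [now rewrite sum_O|].
rewrite sum_Sn IH; unfold plus; simpl; ring.
Qed.

(* The defect form [|u|^2 - |T u|^2] is the norm of the isometric dilation of [T]
   away from [H]; its Toeplitz bound controls what [p(T) x] loses under iteration. *)
Lemma poly_op_defect_bound (a : nat -> C) N M x j :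
  (forall t, Cmod (poly_eval a N (circle_point t)) <= M) ->
  norm (poly_op a N T x) ^ 2 - norm (Nat.iter (S j) T (poly_op a N T x)) ^ 2
    <= M ^ 2 * (norm x ^ 2 - norm (Nat.iter (S (j + N)) T x) ^ 2).
Proof.
intros Ha; pose proof (proj1 T_contraction) as HT.
rewrite -!defect_sum.
rewrite -(sum_n_ext (fun i =>
   norm (sum_n (fun k => scal (a k) (Nat.iter (i + k) T x)) N) ^ 2 -
   norm (T (sum_n (fun k => scal (a k) (Nat.iter (i + k) T x)) N)) ^ 2)).
- apply (toeplitz_bound H (fun u => norm u ^ 2 - norm (T u) ^ 2))
    with (w := fun l => Nat.iter l T x).
  + intros u; apply (proj1 (Rminus_le_0 _ _)), (iter_norm_sqr_le u 1).
  + intros c u; rewrite (linear_scal _ HT) !norm_scal_sqr; ring.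
  + intros h n; now apply is_RInt_parseval_defect.
  + exact Ha.
- intros i; now rewrite iter_poly_op.
Qed.

Lemma poly_op_iter_bound (a : nat -> C) N M x n :
  (forall t, Cmod (poly_eval a N (circle_point t)) <= M) ->
  sum_n (fun j => norm (Nat.iter j T (poly_op a N T x)) ^ 2) n
    <= M ^ 2 * sum_n (fun l => norm (Nat.iter l T x) ^ 2) (n + N).
Proof.
intros Ha; pose proof (proj1 T_contraction) as HT.
rewrite (sum_n_ext _ (fun i =>
   norm (sum_n (fun k => scal (a k) (Nat.iter (i + k) T x)) N) ^ 2)).
- apply (toeplitz_bound H (fun u => norm u ^ 2)) with (w := fun l => Nat.iter l T x).
  + intros u; apply pow2_ge_0.
  + intros c u; apply norm_scal_sqr.
  + apply parseval.
  + exact Ha.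
- intros i; now rewrite iter_poly_op.
Qed.

Theorem von_neumann (a : nat -> C) N M x :
  (forall t, Cmod (poly_eval a N (circle_point t)) <= M) ->
  norm (poly_op a N T x) <= M * norm x.
Proof.
intros Ha.
assert (HM : 0 <= M) by (apply Rle_trans with (2 := Ha 0); apply Cmod_ge_0).
set (X := fun l => norm (Nat.iter l T x) ^ 2).
set (A := fun j => norm (Nat.iter j T (poly_op a N T x)) ^ 2).
assert (HX : forall l, X l <= X 0%nat) by (intros l; apply (iter_norm_sqr_le x)).
assert (HX0 : 0 <= X 0%nat) by apply pow2_ge_0.
assert (HM2 : 0 <= M ^ 2) by apply pow2_ge_0.
(* The defect bound: what [p(T) x] loses in [j] steps is at most [M^2] times what [x] loses in
   [j + N] steps. *)
assert (Hstep : forall j, A 0%nat <= A j + M ^ 2 * (X 0%nat - X (j + N)%nat)).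
{ intros [|j].
  - generalize (Rmult_le_pos _ _ HM2 (proj1 (Rminus_le_0 _ _) (HX (0 + N)%nat))); lra.
  - generalize (poly_op_defect_bound a N M x j Ha); unfold A, X;
      simpl Nat.iter; simpl Nat.add; lra. }
(* The first [N] terms of the orbit sum are each at most [X 0]; the rest is the sum that occurs in
   [Hsum]. *)
assert (Htail : forall n,
  sum_n X (n + N) <= INR N * X 0%nat + sum_n (fun j => X (j + N)%nat) n).
{ induction n as [|n IH].
  - simpl; rewrite sum_O; simpl.
    clear Hstep; induction N as [|K IHK]; [rewrite sum_O; simpl; lra|].
    rewrite sum_Sn S_INR; unfold plus; simpl.
    enough (sum_n X K <= (INR K + 1) * X 0%nat) by lra.
    clear -HX; induction K as [|K IHK]; [rewrite sum_O; simpl; lra|].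
    rewrite sum_Sn S_INR; unfold plus; simpl; generalize (HX (S K)); lra.
  - simpl Nat.add; rewrite !sum_Sn; unfold plus; simpl; lra. }
assert (Hsum : forall n, (INR n + 1) * A 0%nat
   <= sum_n A n + M ^ 2 * ((INR n + 1) * X 0%nat - sum_n (fun j => X (j + N)%nat) n)).
{ induction n as [|n IH].
  - rewrite !sum_O; simpl INR; generalize (Hstep 0%nat); lra.
  - rewrite !sum_Sn S_INR; unfold plus; simpl AbelianMonoid.plus; generalize (Hstep (S n)).
    simpl; lra. }
(* The sums of [X (j + N)] cancel, leaving a right-hand side independent of [n]; letting [n] grow
   forces [A 0 <= M^2 * X 0]. *)
assert (Hall : forall n, (INR n + 1) * (A 0%nat - M ^ 2 * X 0%nat) <= M ^ 2 * (INR N * X 0%nat)).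
{ intros n; generalize (Hsum n) (poly_op_iter_bound a N M x n Ha)
    (Rmult_le_compat_l _ _ _ HM2 (Htail n)); fold A X; lra. }
assert (Hfin : A 0%nat <= M ^ 2 * X 0%nat).
{ destruct (Rle_lt_dec (A 0%nat) (M ^ 2 * X 0%nat)) as [|Hlt]; [easy|exfalso].
  destruct (INR_archimed (A 0%nat - M ^ 2 * X 0%nat) (M ^ 2 * (INR N * X 0%nat))) as [n Hn]; [lra|].
  generalize (Hall n); lra. }
apply Rsqr_incr_0.
- rewrite !Rsqr_pow2; unfold A, X in Hfin; simpl Nat.iter in Hfin; lra.
- apply norm_ge_0.
- apply Rmult_le_pos; [easy | apply norm_ge_0].
Qed.

End VonNeumann.

(** * The operator Bernstein inequality *)

(** Cauchy-Schwarz against the constant sequence. *)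
Lemma sum_n_sqr_le (b : nat -> R) n :
  sum_n b n ^ 2 <= INR (S n) * sum_n (fun j => b j ^ 2) n.
Proof.
induction n as [|n IH]; [rewrite !sum_O; simpl; lra|].
rewrite !sum_Sn (S_INR (S n)); unfold plus; simpl AbelianMonoid.plus.
set (p := INR (S n)) in *; set (s := sum_n b n) in *.
set (q := sum_n (fun j => b j ^ 2) n) in *; set (c := b (S n)).
assert (Hp : 0 < p) by (apply lt_0_INR; lia).
(* Multiplied by [p], this is [(s - p * c)^2 >= 0] combined with the induction hypothesis
   [s^2 <= p * q]. *)
assert (Hcross : 2 * s * c <= q + p * c ^ 2).
{ apply Rmult_le_reg_l with p; [easy|].
  generalize (pow2_ge_0 (s - p * c)); nra. }
change ((s + c) ^ 2 <= (p + 1) * (q + c ^ 2)).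
nra.
Qed.

(** Used with [a = T u], [b = T' v] and [s = T v]: the perturbation of the vector is separated from
    that of the operator. *)
Lemma minus_plus_plus {G : AbelianGroup} (a b c s : G) :
  minus (plus a c) (plus b c) = plus (minus a s) (minus s b).
Proof.
rewrite -minus_trans; unfold minus.
now rewrite opp_plus (plus_comm (opp b)) -plus_assoc (plus_assoc c) plus_opp_r plus_zero_l.
Qed.

Section Horner.
Context {H : Hilbert}.

(* The partial results of Horner's scheme for [p(T) x], padded with zeros so that they
   form the Toeplitz product of [a] with one sequence of vectors. *)
Definition horner (a : nat -> C) (N : nat) (T : H -> H) (x : H) (j : nat) : H :=
  sum_n (fun k => scal (a k)
    (if (N <=? j + k)%nat then Nat.iter (j + k - N) T x else zero)) N.

Lemma linear_zero (T : H -> H) : is_linear T -> T zero = zero.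
Proof.
intros HT.
transitivity (T (scal (zero : C_AbsRing) zero)).
- f_equal; symmetry; apply (scal_zero_r (V := H)).
- rewrite (linear_scal _ HT); apply (scal_zero_l (V := H)).
Qed.

(** The inhomogeneous term does not involve [T], so it cancels when two operators are compared. *)
Lemma horner_S a N T x j : is_linear T ->
  horner a N T x (S j) = plus (T (horner a N T x j))
    (sum_n (fun k => scal (a k) (if (S (j + k) =? N)%nat then x else zero)) N).
Proof.
intros HT; unfold horner; rewrite (linear_sum_n T) //.
etransitivity; [|apply @sum_n_plus].
apply sum_n_ext; intros k; rewrite (linear_scal _ HT) -scal_distr_l; f_equal.
simpl Nat.add.
destruct (Nat.leb_spec N (S (j + k))), (Nat.leb_spec N (j + k)),
  (Nat.eqb_spec (S (j + k)) N); try lia.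
- rewrite plus_zero_r; now replace (S (j + k) - N)%nat with (S (j + k - N)) by lia.
- rewrite (linear_zero T HT) plus_zero_l.
  now replace (S (j + k) - N)%nat with 0%nat by lia.
- now rewrite (linear_zero T HT) plus_zero_l.
Qed.

Lemma horner_last a N T x : horner a N T x N = poly_op a N T x.
Proof.
apply sum_n_ext; intros k; f_equal.
replace (N <=? N + k)%nat with true by (symmetry; apply Nat.leb_le; lia).
f_equal; lia.
Qed.

Lemma horner_0 a N T x : horner a N T x 0 = scal (a N) x.
Proof.
unfold horner; destruct N as [|N]; [now rewrite sum_O|].
rewrite sum_Sn (sum_n_ext_loc _ (fun _ => zero)).
- rewrite /sum_n sum_n_m_const_zero plus_zero_l; f_equal.
  simpl; rewrite Nat.leb_refl Nat.sub_diag //.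
- intros k Hk; destruct (Nat.leb_spec (S N) (0 + k)); [lia | apply @scal_zero_r].
Qed.

(** One Horner step sends the old error through the contraction [T] and adds [(T - T')] applied to
    the current partial result; errors therefore only accumulate additively. *)
Lemma horner_difference a N (T T' : H -> H) d x j : contraction T -> contraction T' ->
  (forall u, norm (minus (T u) (T' u)) <= d * norm u) ->
  norm (minus (horner a N T x (S j)) (horner a N T' x (S j)))
    <= d * sum_n (fun i => norm (horner a N T' x i)) j.
Proof.
intros HT HT' Hd.
pose proof (proj1 HT) as LT; pose proof (proj1 HT') as LT'.
assert (Hstep : forall i, norm (minus (horner a N T x (S i)) (horner a N T' x (S i)))
  <= norm (minus (horner a N T x i) (horner a N T' x i)) + d * norm (horner a N T' x i)).
{ intros i; rewrite !horner_S //.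
  set (u := horner a N T x i); set (v := horner a N T' x i); set (c := sum_n _ _).
  apply Rle_trans with (norm (plus (T (minus u v)) (minus (T v) (T' v)))).
  - right; rewrite (linear_minus T u v LT); f_equal; apply (minus_plus_plus (G := H)).
  - apply Rle_trans with (1 := norm_triangle (V := H) _ _).
    apply Rplus_le_compat; [now apply contraction_norm | apply Hd]. }
induction j as [|j IH].
- rewrite sum_O; apply Rle_trans with (1 := Hstep 0%nat).
  rewrite !horner_0 minus_eq_zero norm_zero; lra.
- rewrite sum_Sn; apply Rle_trans with (1 := Hstep (S j)).
  unfold plus; simpl AbelianMonoid.plus.
  apply Rle_trans with (1 := Rplus_le_compat_r _ _ _ IH).
  right; symmetry; apply Rmult_plus_distr_l.
Qed.

(* The Horner partial results are the image of [(T'^l x)_l] under a Hankel operator with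
   symbol [p], which is a Toeplitz operator after reversing the order of one index. *)
Lemma horner_hankel_bound a n (T' : H -> H) M x : contraction T' ->
  (forall t, Cmod (poly_eval a (S n) (circle_point t)) <= M) ->
  sum_n (fun j => norm (horner a (S n) T' x j) ^ 2) n <= M ^ 2 * (INR (S n) * norm x ^ 2).
Proof.
intros HT' Ha.
set (w := fun l => if (S n <=? l)%nat then Nat.iter (l - S n) T' x else zero).
apply Rle_trans with (M ^ 2 * sum_n (fun l => norm (w l) ^ 2) (n + S n)).
- exact (toeplitz_bound H (fun u => norm u ^ 2) (fun u => pow2_ge_0 (norm u))
    (norm_scal_sqr H) (parseval H) a (S n) M w n Ha).
- apply Rmult_le_compat_l; [apply pow2_ge_0|].
  (* Of the entries of [w] up to [n + S n] only the last [S n] can be nonzero, each of norm at most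
     [norm x]. *)
  rewrite -(sum_n_const n) -(sum_n_shift (fun _ => norm x ^ 2) (S n) n (n + S n)); [|lia].
  apply sum_n_le_R; intros l Hl; unfold w.
  destruct (Nat.leb_spec (S n) l); cbn [andb].
  + replace (l - S n <=? n)%nat with true by (symmetry; apply Nat.leb_le; lia).
    now apply iter_norm_sqr_le.
  + rewrite norm_zero; unfold zero; simpl; lra.
Qed.

Theorem operator_bernstein a N (T T' : H -> H) M d x : contraction T -> contraction T' ->
  0 <= d -> (forall u, norm (minus (T u) (T' u)) <= d * norm u) ->
  (forall t, Cmod (poly_eval a N (circle_point t)) <= M) ->
  norm (minus (poly_op a N T x) (poly_op a N T' x)) <= INR N * M * d * norm x.
Proof.
intros HT HT' Hd0 Hd Ha.
assert (HM : 0 <= M) by (apply Rle_trans with (2 := Ha 0); apply Cmod_ge_0).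
rewrite -!horner_last; destruct N as [|n].
- rewrite !horner_0 minus_eq_zero norm_zero; simpl; lra.
- apply Rle_trans with (1 := horner_difference a (S n) T T' d x n HT HT' Hd).
  replace (INR (S n) * M * d * norm x) with (d * (INR (S n) * M * norm x)) by ring.
  apply Rmult_le_compat_l; [easy|].
  assert (Hx := norm_ge_0 x); assert (Hn := pos_INR (S n)).
  (* Cauchy-Schwarz and the bound on the sum of squares each contribute a factor [N] to the square,
     hence one factor [N] in the end. *)
  apply Rsqr_incr_0_var; [|now repeat apply Rmult_le_pos].
  rewrite !Rsqr_pow2.
  apply Rle_trans with (1 := sum_n_sqr_le _ _).
  apply Rle_trans with (1 := Rmult_le_compat_l _ _ _ Hn (horner_hankel_bound a n T' M x HT' Ha)).
  right; ring.
Qed.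

End Horner.

(** * Integrals of complex functions *)

(* [ring] and unification do not see through the carriers of Coquelicot's hierarchy. *)
Ltac Ceq := match goal with |- ?a = ?b => change (@eq C a b) end.
Ltac Cring := Ceq; ring.
Ltac Rring := match goal with |- ?a = ?b => change (@eq R a b) end; ring.

Lemma C_inner_norm (x : C) : (x * Cconj x)%C = RtoC (norm (x : C_CompleteNormedModule) ^ 2).
Proof. symmetry; exact (Cmod2_conj x). Qed.

(** Serves twice: for the scalar Parseval identity, and to regard evaluation at [z] as the calculus
    of multiplication by [z]. *)
Definition C_hilbert : Hilbert.
Proof.
refine (Build_Hilbert C_CompleteNormedModule (fun x y => x * Cconj y)%C _ _ _ _).
- intros x y z; apply Cmult_plus_distr_r.
- intros a x y; symmetry; apply Cmult_assoc.
- intros x y; rewrite Cmult_conj Cconj_conj; apply Cmult_comm.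
- exact C_inner_norm.
Defined.

Lemma norm_C_hilbert (x : C_hilbert) : norm x = Cmod x.
Proof. easy. Qed.

Lemma norm_C_R (x : C) : norm (x : C_R_NormedModule) = Cmod x.
Proof. symmetry; apply Cmod_norm. Qed.

Lemma sum_n_zero_tail {G : AbelianMonoid} (u : nat -> G) n m : (n <= m)%nat ->
  (forall k, (n < k)%nat -> u k = zero) -> sum_n u m = sum_n u n.
Proof.
intros Hnm Hu; induction Hnm as [|m Hnm IH]; [easy|].
now rewrite sum_Sn IH Hu ?plus_zero_r; [|lia].
Qed.

(** Integrals are taken in the real normed module [C_R_NormedModule], so a complex constant has to
    be pulled out componentwise. *)
Lemma is_RInt_Cmult_l (c : C) (g : R -> C) a b (l : C) :
  is_RInt (V := C_R_NormedModule) g a b l ->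
  is_RInt (V := C_R_NormedModule) (fun t => c * g t)%C a b (c * l)%C.
Proof.
intros Hg.
pose proof (is_RInt_fct_extend_fst (U := R_NormedModule) (V := R_NormedModule) _ _ _ _ Hg) as H1.
pose proof (is_RInt_fct_extend_snd (U := R_NormedModule) (V := R_NormedModule) _ _ _ _ Hg) as H2.
apply (is_RInt_fct_extend_pair (U := R_NormedModule) (V := R_NormedModule)).
- apply @is_RInt_minus; apply @is_RInt_scal; [exact H1 | exact H2].
- apply @is_RInt_plus; apply @is_RInt_scal; [exact H2 | exact H1].
Qed.

Lemma is_RInt_Csum_n (u : nat -> R -> C) (l : nat -> C) a b n :
  (forall k, (k <= n)%nat -> is_RInt (V := C_R_NormedModule) (u k) a b (l k)) ->
  is_RInt (V := C_R_NormedModule) (fun t => sum_n (G := C_AbelianMonoid) (fun k => u k t) n) a b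
    (sum_n (G := C_AbelianMonoid) l n).
Proof.
induction n as [|n IH]; intros Hu.
- apply is_RInt_ext with (u 0%nat); [intros t _; now rewrite sum_O|].
  rewrite sum_O; now apply Hu.
- apply is_RInt_ext with (fun t => plus
    (sum_n (G := C_AbelianMonoid) (fun k => u k t) n : C_R_NormedModule) (u (S n) t)).
  + intros t _; now rewrite sum_Sn.
  + rewrite sum_Sn.
    apply (is_RInt_plus (V := C_R_NormedModule));
      [apply IH; intros; apply Hu; lia | now apply Hu].
Qed.

Lemma is_RInt_circle_point (n : Z) :
  is_RInt (V := C_R_NormedModule) (fun t => circle_point (IZR n * t)) 0 (2 * PI)
    (RtoC (if (n =? 0)%Z then 2 * PI else 0)).
Proof.
apply (is_RInt_fct_extend_pair (U := R_NormedModule) (V := R_NormedModule)); simpl.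
- destruct (Z.eqb_spec n 0) as [-> | Hn]; [|now apply is_RInt_cos].
  apply is_RInt_ext with (fun _ => 1); [intros t _; now rewrite Rmult_0_l cos_0|].
  eapply is_RInt_eq; [apply @is_RInt_const|].
  unfold scal; simpl; unfold mult; simpl; ring.
- apply is_RInt_sin.
Qed.

Lemma continuous_C_components (u : R -> C) t : continuous (U := C_R_NormedModule) u t ->
  continuous (fun s => fst (u s)) t /\ continuous (fun s => snd (u s)) t.
Proof.
intros Hu; split.
- apply (continuous_comp (V := C_R_NormedModule) (W := R_UniformSpace) u fst); [exact Hu|].
  apply (continuous_fst (U := R_UniformSpace) (V := R_UniformSpace)).
- apply (continuous_comp (V := C_R_NormedModule) (W := R_UniformSpace) u snd); [exact Hu|].
  apply (continuous_snd (U := R_UniformSpace) (V := R_UniformSpace)).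
Qed.

Lemma continuous_C_pair (u v : R -> R) t : continuous u t -> continuous v t ->
  continuous (U := C_R_NormedModule) (fun s => (u s, v s)) t.
Proof.
intros Hu Hv.
apply (continuous_comp_2 (U := R_UniformSpace) (V := R_UniformSpace) (W := R_UniformSpace)
  (X := C_R_NormedModule) u v (fun x y => (x, y))); [exact Hu | exact Hv |].
apply continuous_ext with (fun z : R * R => z); [now intros []|].
apply continuous_id.
Qed.

Lemma continuous_Cmult (u v : R -> C) t :
  continuous (U := C_R_NormedModule) u t -> continuous (U := C_R_NormedModule) v t ->
  continuous (U := C_R_NormedModule) (fun s => u s * v s)%C t.
Proof.
intros Hu Hv.
destruct (continuous_C_components u t Hu) as [Hu1 Hu2].
destruct (continuous_C_components v t Hv) as [Hv1 Hv2].
apply continuous_C_pair.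
- apply @continuous_minus; now apply @continuous_mult.
- apply @continuous_plus; now apply @continuous_mult.
Qed.

(** * Fourier coefficients of Hoelder functions *)

Lemma circle_point_on_circle t : on_circle (circle_point t).
Proof. apply Cmod_circle_point. Qed.

Lemma sin_sqr_le x : sin x ^ 2 <= x ^ 2.
Proof.
assert (Hpos : forall y, 0 < y -> sin y ^ 2 <= y ^ 2).
{ intros y Hy; generalize (SIN_bound y); intros Hb.
  destruct (Rle_lt_dec 1 y); [nra|].
  assert (0 < sin y) by (apply sin_gt_0; generalize PI2_1; lra).
  generalize (sin_lt_x y Hy); nra. }
destruct (Rtotal_order 0 x) as [Hx | [<- | Hx]].
- now apply Hpos.
- rewrite sin_0; lra.
- generalize (Hpos (- x)); rewrite sin_neg; nra.
Qed.

Lemma one_minus_cos_le x : 2 * (1 - cos x) <= x ^ 2.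
Proof.
replace x with (2 * (x / 2)) at 1 by field.
rewrite cos_2a_sin; generalize (sin_sqr_le (x / 2)); nra.
Qed.

Lemma Cmod_circle_point_minus s t : Cmod (circle_point s - circle_point t) <= Rabs (s - t).
Proof.
apply Rsqr_incr_0; [|apply Cmod_ge_0 | apply Rabs_pos].
rewrite -Rsqr_abs !Rsqr_pow2 Cmod2_alt.
apply Rle_trans with (2 := one_minus_cos_le (s - t)).
unfold Re, Im; simpl; rewrite cos_minus.
generalize (sin2_cos2 s) (sin2_cos2 t); unfold Rsqr; lra.
Qed.

(* Trades the power [alpha] for a second moment: [y ^ alpha <= 1 + y ^ 2]. *)
Lemma rpow_le alpha d m : 0 < alpha < 1 -> 0 <= d -> 0 < m ->
  rpow d alpha <= Rpower m (- alpha) * (1 + (m * d) ^ 2).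
Proof.
intros Ha Hd Hm.
assert (Hp : 0 < Rpower m (- alpha)) by apply exp_pos.
unfold rpow; destruct (Req_EM_T d 0) as [Hd0 | Hd0].
- apply Rmult_le_pos; [lra | generalize (pow2_ge_0 (m * d)); lra].
- assert (Hd1 : 0 < d) by lra.
  assert (Hmd : 0 < m * d) by now apply Rmult_lt_0_compat.
  replace (Rpower d alpha) with (Rpower m (- alpha) * Rpower (m * d) alpha).
  + apply Rmult_le_compat_l; [lra|].
    destruct (Rle_lt_dec (m * d) 1) as [H1 | H1].
    * apply Rle_trans with (Rpower 1 alpha); [apply Rle_Rpower_l; lra|].
      unfold Rpower; rewrite ln_1 Rmult_0_r exp_0; generalize (pow2_ge_0 (m * d)); lra.
    * apply Rle_trans with (Rpower (m * d) 1); [apply Rle_Rpower; lra|].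
      rewrite Rpower_1 //; nra.
  + rewrite -Rpower_mult_distr //.
    rewrite -Rmult_assoc -Rpower_plus Rplus_opp_l Rpower_O //; ring.
Qed.

Section Holder.
Context (alpha L : R) (f : C -> C).
Hypothesis Halpha : 0 < alpha < 1.
Hypothesis HL : 0 <= L.
Hypothesis Hf : forall z w, on_circle z -> on_circle w ->
  Cmod (f z - f w) <= L * rpow (Cmod (z - w)) alpha.

(** [m] is a free frequency: the degree in the Jackson estimate, an inverse radius in the proof of
    continuity. *)
Lemma holder_moment z w m : on_circle z -> on_circle w -> 0 < m ->
  Cmod (f z - f w) <= L * Rpower m (- alpha) * (1 + (m * Cmod (z - w)) ^ 2).
Proof.
intros Hz Hw Hm; apply Rle_trans with (1 := Hf z w Hz Hw).
rewrite Rmult_assoc; apply Rmult_le_compat_l; [easy|].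
now apply rpow_le; [|apply Cmod_ge_0|].
Qed.

Lemma holder_continuous t :
  continuous (U := C_R_NormedModule) (fun s => f (circle_point s)) t.
Proof.
apply (filterlim_locally_ball_norm (K := R_AbsRing) (U := C_R_NormedModule)).
intros eps.
(* Within distance [1 / m] the moment factor is at most 2, and this [m] turns the bound into
   [2 * L / (2 * L / eps + 1)]. The [+ 1] makes it strictly less than [eps] and covers [L = 0]. *)
set (m := Rpower (2 * L / eps + 1) (/ alpha)).
assert (Heps := cond_pos eps).
assert (Hq : 0 <= 2 * L / eps) by (apply Rmult_le_pos; [lra | left; now apply Rinv_0_lt_compat]).
assert (Hm : 0 < m) by apply exp_pos.
assert (Hma : Rpower m (- alpha) = / (2 * L / eps + 1)).
{ unfold m; rewrite Rpower_mult.
  replace (/ alpha * - alpha) with (- 1) by (field; lra).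
  rewrite Rpower_Ropp Rpower_1 //; lra. }
exists (mkposreal (/ m) (Rinv_0_lt_compat _ Hm)); intros s Hs.
unfold ball_norm; rewrite norm_C_R.
change (Rabs (s - t) < / m) in Hs.
apply Rle_lt_trans with (1 := holder_moment (circle_point s) (circle_point t) m
  (circle_point_on_circle s) (circle_point_on_circle t) Hm).
rewrite Hma.
assert (Hd : m * Cmod (circle_point s - circle_point t) <= 1).
{ apply Rle_trans with (m * / m); [|right; field; lra].
  apply Rmult_le_compat_l; [lra|].
  apply Rle_trans with (1 := Cmod_circle_point_minus s t); lra. }
assert (Hd0 : 0 <= m * Cmod (circle_point s - circle_point t))
  by (apply Rmult_le_pos; [lra | apply Cmod_ge_0]).
apply Rle_lt_trans with (L * / (2 * L / eps + 1) * 2).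
- apply Rmult_le_compat_l; [|nra].
  apply Rmult_le_pos; [easy | left; apply Rinv_0_lt_compat; lra].
- apply Rmult_lt_reg_r with (2 * L / eps + 1); [lra|].
  replace (L * / (2 * L / eps + 1) * 2 * (2 * L / eps + 1)) with (2 * L) by (field; lra).
  replace (eps * (2 * L / eps + 1)) with (2 * L + eps) by (field; lra).
  lra.
Qed.

(** [RInt] is total; continuity of [f] on the circle makes it an actual integral here. *)
Lemma is_RInt_fourier n :
  is_RInt (V := C_R_NormedModule)
    (fun t => f (circle_point t) * circle_point (- (IZR n * t)))%C 0 (2 * PI)
    (RtoC (2 * PI) * fourier f n)%C.
Proof.
eapply is_RInt_eq.
- apply (RInt_correct (V := C_R_CompleteNormedModule)).
  apply (ex_RInt_continuous (V := C_R_CompleteNormedModule)); intros t _.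
  apply continuous_Cmult; [apply holder_continuous|].
  apply (continuous_comp (V := R_UniformSpace) (W := C_R_NormedModule)
    (fun t : R => - (IZR n * t)) circle_point).
  + apply (ex_derive_continuous (fun t : R => - (IZR n * t))); now auto_derive.
  + apply continuous_C_pair; [apply continuous_cos | apply continuous_sin].
- unfold fourier; rewrite Cmult_assoc -RtoC_mult.
  replace (2 * PI * / (2 * PI)) with 1; [now rewrite Cmult_1_l|].
  field; apply PI_neq0.
Qed.

End Holder.

(** * A Jackson kernel *)

Lemma Cconj_sum_n (u : nat -> C) n :
  Cconj (sum_n u n) = sum_n (fun k => Cconj (u k)) n.
Proof.
induction n as [|n IH]; [now rewrite !sum_O|].
rewrite !sum_Sn -IH; apply Cplus_conj.
Qed.

Lemma RtoC_sum_n (u : nat -> R) n : RtoC (sum_n u n) = sum_n (fun k => RtoC (u k)) n.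
Proof.
induction n as [|n IH]; [now rewrite !sum_O|].
rewrite !sum_Sn -IH; apply RtoC_plus.
Qed.

Lemma Cmult_sum_n_l (c : C) (u : nat -> C) n :
  (c * sum_n u n)%C = sum_n (fun k => c * u k)%C n.
Proof. symmetry; exact (sum_n_mult_l (K := C_Ring) c u n). Qed.

Lemma Cmult_sum_n_r (c : C) (u : nat -> C) n :
  (sum_n u n * c)%C = sum_n (fun k => u k * c)%C n.
Proof. symmetry; exact (sum_n_mult_r (K := C_Ring) c u n). Qed.

Lemma Cmod_sqr_poly_eval (b : nat -> R) n (y : C) :
  RtoC (Cmod (poly_eval (fun k => RtoC (b k)) n y) ^ 2)
  = sum_n (fun k => sum_n (fun j => RtoC (b j * b k) * (y ^ j * Cconj y ^ k))%C n) n.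
Proof.
rewrite Cmod2_conj Cconj_sum_n.
rewrite Cmult_sum_n_l; apply sum_n_ext; intros k.
unfold poly_eval; rewrite Cmult_sum_n_r; apply sum_n_ext; intros j.
rewrite Cmult_conj Cpow_conj RtoC_mult.
replace (Cconj (b k)) with (RtoC (b k)); [Cring|].
unfold Cconj, RtoC; simpl; now rewrite Ropp_0.
Qed.

Lemma conj_on_circle z : on_circle z -> on_circle (Cconj z).
Proof. unfold on_circle; now rewrite Cmod_conj. Qed.

Lemma on_circle_conj z : on_circle z -> (z * Cconj z)%C = 1.
Proof. intros Hz; rewrite -Cmod2_conj Hz pow1 //. Qed.

Lemma is_RInt_poly_sqr (b : nat -> R) n (z : C) : on_circle z ->
  is_RInt (fun t => Cmod (poly_eval (fun k => RtoC (b k)) n (z * circle_point (- t))) ^ 2)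
    0 (2 * PI) (2 * PI * sum_n (fun k => b k ^ 2) n).
Proof.
intros Hz.
(* Conjugation leaves the modulus unchanged and yields a polynomial in [e^(it)] with coefficients
   [b k * Cconj z ^ k], to which [parseval] applies. *)
apply is_RInt_ext with (fun t => norm (sum_n (fun k =>
   scal (circle_point t ^ k)%C (RtoC (b k) * Cconj z ^ k : C_hilbert)%C) n) ^ 2).
- intros t _; rewrite norm_C_hilbert -Cmod_conj; do 2 f_equal.
  unfold poly_eval; rewrite Cconj_sum_n; apply sum_n_ext; intros k.
  rewrite !Cmult_conj !Cpow_conj Cconj_conj circle_point_conj Cpow_mult_l.
  replace (Cconj (b k)) with (RtoC (b k))
    by (unfold Cconj, RtoC; simpl; now rewrite Ropp_0).
  unfold scal; simpl; unfold mult; simpl; Cring.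
- eapply is_RInt_eq; [apply (parseval C_hilbert)|].
  f_equal; apply sum_n_ext; intros k.
  rewrite norm_C_hilbert Cmod_mult Cmod_pow (conj_on_circle z Hz) pow1 Rmult_1_r Cmod_R.
  apply pow2_abs.
Qed.

Section Kernel.
Context (m : nat).

(** With this angle [sin (k * kernel_angle)] vanishes at both ends [k = 0] and [k = m + 1]. *)
Definition kernel_angle : R := PI / INR (S m).

(* The ground state of the discrete Dirichlet Laplacian: the positive kernel
   [|sum_k c_k e^(ikt)|^2] has the least possible second moment for its degree. *)
Definition kernel_coef (k : nat) : R :=
  if (k <=? m)%nat then sin (INR k * kernel_angle) else 0.

Definition kernel_mass : R := sum_n (fun k => kernel_coef k ^ 2) m.

Lemma kernel_angle_pos : 0 < kernel_angle.
Proof. apply Rdiv_lt_0_compat; [apply PI_RGT_0 | apply lt_0_INR; lia]. Qed.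

Lemma kernel_coef_sin k : (k <= S m)%nat -> kernel_coef k = sin (INR k * kernel_angle).
Proof.
intros Hk; unfold kernel_coef; destruct (Nat.leb_spec k m); [easy|].
replace k with (S m) by lia; unfold kernel_angle.
replace (INR (S m) * (PI / INR (S m))) with PI; [now rewrite sin_PI|].
field; apply not_0_INR; lia.
Qed.

Lemma kernel_coef_beyond k : (m < k)%nat -> kernel_coef k = 0.
Proof. intros Hk; unfold kernel_coef; destruct (Nat.leb_spec k m); [lia | easy]. Qed.

Lemma kernel_coef_0 : kernel_coef 0 = 0.
Proof. rewrite kernel_coef_sin; [simpl; now rewrite Rmult_0_l sin_0 | lia]. Qed.

Lemma kernel_mass_pos : (0 < m)%nat -> 0 < kernel_mass.
Proof.
intros Hm.
assert (H1 : 0 < kernel_coef 1 ^ 2).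
{ apply pow_lt; rewrite kernel_coef_sin; [|lia].
  simpl; rewrite Rmult_1_l; apply sin_gt_0; [apply kernel_angle_pos|].
  unfold kernel_angle; apply Rmult_lt_reg_r with (INR (S m)); [apply lt_0_INR; lia|].
  replace (PI / INR (S m) * INR (S m)) with PI by (field; apply not_0_INR; lia).
  rewrite -{1}(Rmult_1_r PI); apply Rmult_lt_compat_l; [apply PI_RGT_0|].
  apply lt_1_INR; lia. }
apply Rlt_le_trans with (1 := H1).
rewrite -{1}(sum_O (fun j => kernel_coef (j + 1) ^ 2)).
apply (sum_n_shift_le (fun k => kernel_coef k ^ 2)); [|lia].
intros k; apply pow2_ge_0.
Qed.

(* Summation by parts with [c_(k+1) + c_(k-1) = 2 cos(theta) c_k]. *)
Lemma kernel_coef_energy :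
  sum_n (fun k => (kernel_coef k - kernel_coef (S k)) ^ 2) m
  = 2 * (1 - cos kernel_angle) * kernel_mass.
Proof.
enough (Hgen : forall n, (n <= m)%nat ->
   sum_n (fun k => (kernel_coef k - kernel_coef (S k)) ^ 2) n
   = 2 * (1 - cos kernel_angle) * sum_n (fun k => kernel_coef k ^ 2) n
     + kernel_coef (S n) * (kernel_coef (S n) - kernel_coef n)).
{ rewrite Hgen // (kernel_coef_beyond (S m)); [|lia]; unfold kernel_mass; Rring. }
induction n as [|n IH]; intros Hn.
- rewrite !sum_O kernel_coef_0; Rring.
- rewrite !sum_Sn IH; [|lia]; unfold plus; simpl AbelianMonoid.plus.
  assert (Hrec : kernel_coef (S (S n)) + kernel_coef n = 2 * cos kernel_angle * kernel_coef (S n)).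
  { rewrite !kernel_coef_sin; try lia.
    replace (INR (S (S n)) * kernel_angle) with (INR (S n) * kernel_angle + kernel_angle)
      by (rewrite (S_INR (S n)); ring).
    replace (INR n * kernel_angle) with (INR (S n) * kernel_angle - kernel_angle)
      by (rewrite S_INR; ring).
    rewrite sin_plus sin_minus; ring. }
  replace (kernel_coef n) with (2 * cos kernel_angle * kernel_coef (S n) - kernel_coef (S (S n)))
    by lra.
  unfold plus; simpl; Rring.
Qed.

(** Multiplication by [y - 1] differences the coefficients, without boundary terms because they
    vanish at 0 and [m + 1]. The second moment of the kernel thus becomes a Parseval sum. *)
Lemma kernel_coef_telescope (y : C) :
  ((y - 1) * poly_eval (fun k => RtoC (kernel_coef k)) m y)%C
  = (y * poly_eval (fun k => RtoC (kernel_coef k - kernel_coef (S k))) m y)%C.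
Proof.
enough (Hgen : forall n,
  ((y - 1) * poly_eval (fun k => RtoC (kernel_coef k)) n y)%C
  = (y * poly_eval (fun k => RtoC (kernel_coef k - kernel_coef (S k))) n y
     + RtoC (kernel_coef (S n)) * y ^ S n)%C).
{ rewrite Hgen (kernel_coef_beyond (S m)); [ring | lia]. }
induction n as [|n IH]; unfold poly_eval in *.
- rewrite !sum_O kernel_coef_0 RtoC_minus; simpl; ring.
- rewrite !sum_Sn; unfold plus; simpl AbelianMonoid.plus.
  change ((y - 1) * (sum_n (fun k => RtoC (kernel_coef k) * y ^ k)%C n
     + RtoC (kernel_coef (S n)) * y ^ S n)
   = y * (sum_n (fun k => RtoC (kernel_coef k - kernel_coef (S k)) * y ^ k)%C n
     + RtoC (kernel_coef (S n) - kernel_coef (S (S n))) * y ^ S n)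
     + RtoC (kernel_coef (S (S n))) * y ^ S (S n))%C.
  rewrite Cmult_plus_distr_l IH !RtoC_minus (Cpow_S y (S n)); ring.
Qed.

Lemma is_RInt_kernel (z : C) : on_circle z ->
  is_RInt (fun t =>
    Cmod (poly_eval (fun k => RtoC (kernel_coef k)) m (z * circle_point (- t))) ^ 2)
    0 (2 * PI) (2 * PI * kernel_mass).
Proof. apply is_RInt_poly_sqr. Qed.

Lemma is_RInt_kernel_moment (z : C) : on_circle z ->
  is_RInt (fun t => Cmod (z - circle_point t) ^ 2 *
    Cmod (poly_eval (fun k => RtoC (kernel_coef k)) m (z * circle_point (- t))) ^ 2)
    0 (2 * PI) (2 * PI * (2 * (1 - cos kernel_angle) * kernel_mass)).
Proof.
intros Hz; rewrite -kernel_coef_energy.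
apply is_RInt_ext with (2 := is_RInt_poly_sqr _ m z Hz); intros t _.
set (y := (z * circle_point (- t))%C).
assert (Hy : Cmod y = 1) by (unfold y; rewrite Cmod_mult Cmod_circle_point Hz; ring).
assert (Hz' : z = (circle_point t * y)%C).
{ unfold y; transitivity (z * (circle_point t * circle_point (- t)))%C; [|ring].
  rewrite -circle_point_plus Rplus_opp_r; unfold circle_point; rewrite cos_0 sin_0.
  symmetry; apply Cmult_1_r. }
rewrite -Rpow_mult_distr; f_equal.
replace (z - circle_point t)%C with (circle_point t * (y - 1))%C by (rewrite Hz'; ring).
rewrite Cmod_mult Cmod_circle_point Rmult_1_l -Cmod_mult kernel_coef_telescope.
now rewrite Cmod_mult Hy Rmult_1_l.
Qed.

End Kernel.

(** Convolution with the normalized kernel acts on Fourier coefficients as multiplication by the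
    autocorrelation of its coefficients. *)
Definition jackson_coef (f : C -> C) (m k : nat) : C :=
  (RtoC (sum_n (fun i => kernel_coef m i * kernel_coef m (i + k))%R m / kernel_mass m)
   * fourier f (Z.of_nat k))%C.

Lemma jackson_coef_beyond f m k : (m < k)%nat -> jackson_coef f m k = 0.
Proof.
intros Hk; unfold jackson_coef.
rewrite (sum_n_ext _ (fun _ => 0)).
- rewrite sum_n_const Rmult_0_r Rdiv_0_l; apply Cmult_0_l.
- intros i; rewrite (kernel_coef_beyond m (i + k)); [Rring | lia].
Qed.

(** Since [c_0 = 0], the mean for [m] really has degree at most [m - 1]; the dyadic sum can
    therefore start from a constant. *)
Lemma jackson_coef_1_1 f : jackson_coef f 1 1 = 0.
Proof.
unfold jackson_coef; rewrite sum_Sn sum_O kernel_coef_0 (kernel_coef_beyond 1 (1 + 1)); [|lia].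
unfold plus; simpl; rewrite Rmult_0_l Rmult_0_r Rplus_0_r Rdiv_0_l; apply Cmult_0_l.
Qed.

Lemma is_RInt_poly_fourier (a : nat -> C) n k :
  (forall j, (n < j)%nat -> a j = 0) ->
  is_RInt (V := C_R_NormedModule)
    (fun t => poly_eval a n (circle_point t) * circle_point (- (IZR (Z.of_nat k) * t)))%C
    0 (2 * PI) (RtoC (2 * PI) * a k)%C.
Proof.
intros Ha.
apply is_RInt_ext with (fun t => sum_n (G := C_AbelianMonoid) (fun j =>
   (a j * circle_point (IZR (Z.of_nat j - Z.of_nat k) * t))%C : C) n).
- intros t _; Ceq; unfold poly_eval; rewrite Cmult_sum_n_r.
  apply sum_n_ext; intros j; rewrite circle_point_pow -Cmult_assoc -circle_point_plus.
  do 2 f_equal; rewrite minus_IZR -!INR_IZR_INZ; ring.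
- eapply is_RInt_eq.
  + apply is_RInt_Csum_n; intros j _; apply is_RInt_Cmult_l, is_RInt_circle_point.
  + transitivity (if (k <=? n)%nat then (RtoC (2 * PI) * a k)%C else RtoC 0).
    * clear Ha; induction n as [|n IH].
      -- rewrite sum_O; destruct k as [|k]; simpl; [apply Cmult_comm | apply Cmult_0_r].
      -- rewrite sum_Sn IH.
         destruct (Z.eqb_spec (Z.of_nat (S n) - Z.of_nat k) 0) as [Hd | Hd].
         ++ replace k with (S n) by lia.
            rewrite Nat.leb_refl (proj2 (Nat.leb_gt (S n) n)) //.
            transitivity (0 + a (S n) * RtoC (2 * PI))%C; [reflexivity | Cring].
         ++ rewrite Cmult_0_r.
            replace (k <=? S n)%nat with (k <=? n)%nat; [apply Cplus_0_r|].
            destruct (Nat.leb_spec k n), (Nat.leb_spec k (S n)); lia.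
    * destruct (Nat.leb_spec k n) as [Hk | Hk]; [easy|].
      now rewrite Ha // Cmult_0_r.
Qed.

Section Jackson.
Context (alpha L : R) (f : C -> C) (m : nat).
Hypothesis Halpha : 0 < alpha < 1.
Hypothesis HL : 0 <= L.
Hypothesis Hf : forall z w, on_circle z -> on_circle w ->
  Cmod (f z - f w) <= L * rpow (Cmod (z - w)) alpha.
Hypothesis Hplus : forall n : Z, (n < 0)%Z -> fourier f n = RtoC 0.
Hypothesis Hm : (0 < m)%nat.

Let c := kernel_coef m.
Let kernel (y : C) : R := Cmod (poly_eval (fun k => RtoC (c k)) m y) ^ 2.

Lemma jackson_integral z : on_circle z ->
  is_RInt (V := C_R_NormedModule)
    (fun t => RtoC (kernel (z * circle_point (- t))) * f (circle_point t))%C 0 (2 * PI)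
    (RtoC (2 * PI * kernel_mass m) * poly_eval (jackson_coef f m) m z)%C.
Proof.
intros Hz.
apply is_RInt_ext with (fun t => sum_n (G := C_AbelianMonoid) (fun k =>
   sum_n (G := C_AbelianMonoid) (fun j =>
   (RtoC (c j * c k) * (z ^ j * Cconj z ^ k)
     * (f (circle_point t) * circle_point (- (IZR (Z.of_nat j - Z.of_nat k) * t))))%C
   : C) m) m).
- intros t _; Ceq; unfold kernel; rewrite Cmod_sqr_poly_eval Cmult_sum_n_r.
  apply sum_n_ext; intros k; rewrite Cmult_sum_n_r.
  apply sum_n_ext; intros j.
  rewrite Cmult_conj circle_point_conj !Cpow_mult_l !circle_point_pow.
  replace (circle_point (- (IZR (Z.of_nat j - Z.of_nat k) * t)))
    with (circle_point (INR j * - t) * circle_point (INR k * - - t))%C; [Cring|].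
  rewrite -circle_point_plus; f_equal.
  rewrite minus_IZR -!INR_IZR_INZ; ring.
- eapply is_RInt_eq.
  + apply is_RInt_Csum_n; intros k _; apply is_RInt_Csum_n; intros j _.
    apply is_RInt_Cmult_l, (is_RInt_fourier alpha L); assumption.
  + Ceq; unfold poly_eval, jackson_coef; rewrite Cmult_sum_n_l.
    (* Collect the double sum along the diagonals [l = j - k], with [i = k]. *)
    transitivity (sum_n (fun l => sum_n (fun i =>
       RtoC (2 * PI) * (RtoC (c i * c (i + l)%nat) * (fourier f (Z.of_nat l) * z ^ l)))%C m) m).
    * rewrite [X in _ = X]sum_n_switch; apply (sum_n_ext_loc (G := C_AbelianMonoid)); intros k Hk.
      rewrite (sum_n_zero_tail (G := C_AbelianMonoid) (fun l => RtoC (2 * PI)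
          * (RtoC (c k * c (k + l)%nat) * (fourier f (Z.of_nat l) * z ^ l)))%C (m - k) m); [|lia|].
      -- rewrite -(sum_n_shift (G := C_AbelianMonoid) _ k (m - k) m); [|lia].
         apply (sum_n_ext_loc (G := C_AbelianMonoid)); intros j Hj.
         destruct (Nat.leb_spec k j); cbn [andb].
         ++ replace (j - k <=? m - k)%nat with true by (symmetry; apply Nat.leb_le; lia).
            replace (k + (j - k))%nat with j by lia.
            replace (Z.of_nat j - Z.of_nat k)%Z with (Z.of_nat (j - k)) by lia.
            replace (z ^ j)%C with (z ^ (j - k) * z ^ k)%C
              by (rewrite -Cpow_add_r; f_equal; lia).
            transitivity (RtoC (2 * PI) * (RtoC (c k * c j)
              * (fourier f (Z.of_nat (j - k)) * z ^ (j - k))) * (z * Cconj z) ^ k)%C.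
            ** rewrite Cpow_mult_l (Rmult_comm (c k)); Cring.
            ** rewrite on_circle_conj // Cpow_1_l; Cring.
         (* For [j < k] the Fourier coefficient has negative index; its vanishing makes the mean an
            analytic polynomial. *)
         ++ rewrite Hplus; [|lia]; rewrite !Cmult_0_r; reflexivity.
      -- intros l Hl; unfold c; rewrite (kernel_coef_beyond m (k + l)); [|lia].
         rewrite Rmult_0_r Cmult_0_l; apply Cmult_0_r.
    * apply sum_n_ext; intros l.
      rewrite -Cmult_sum_n_l -Cmult_sum_n_r -RtoC_sum_n.
      pose proof (kernel_mass_pos m Hm).
      transitivity (RtoC (2 * PI * kernel_mass m)
        * RtoC (sum_n (fun i => c i * c (i + l)%nat)%R m / kernel_mass m)
        * (fourier f (Z.of_nat l) * z ^ l))%C; [|unfold c; Cring].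
      rewrite -RtoC_mult Cmult_assoc -RtoC_mult; do 2 f_equal; field; lra.
Qed.

(** The error is the average of [f z - f (e^(it))] against a positive kernel. In [holder_moment] the
    term 1 contributes the total mass and the second moment, scaled by [m^2], contributes at most
    [PI^2]. *)
Lemma jackson_approx z : on_circle z ->
  Cmod (f z - poly_eval (jackson_coef f m) m z) <= (1 + PI ^ 2) * L * Rpower (INR m) (- alpha).
Proof.
intros Hz.
assert (Hm0 : 0 < INR m) by (apply lt_0_INR; lia).
assert (HS := kernel_mass_pos m Hm).
assert (HPI := PI_RGT_0).
set (B := L * Rpower (INR m) (- alpha)).
assert (HB : 0 <= B) by (apply Rmult_le_pos; [easy | left; apply exp_pos]).
assert (Hint : is_RInt (V := C_R_NormedModule)
   (fun t => RtoC (kernel (z * circle_point (- t))) * (f z - f (circle_point t)))%C 0 (2 * PI)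
   (RtoC (2 * PI * kernel_mass m) * (f z - poly_eval (jackson_coef f m) m z))%C).
{ apply is_RInt_ext with (fun t => minus
    (f z * RtoC (kernel (z * circle_point (- t))) : C_R_NormedModule)%C
    (RtoC (kernel (z * circle_point (- t))) * f (circle_point t) : C_R_NormedModule)%C).
  - intros t _; unfold minus, plus, opp; simpl.
    Ceq.
    transitivity (f z * RtoC (kernel (z * circle_point (- t)))
      - RtoC (kernel (z * circle_point (- t))) * f (circle_point t))%C; [reflexivity | ring].
  - eapply is_RInt_eq.
    + apply @is_RInt_minus; [|now apply jackson_integral].
      apply is_RInt_Cmult_l.
      apply (is_RInt_fct_extend_pair (U := R_NormedModule) (V := R_NormedModule)); simpl.
      * now apply is_RInt_kernel.
      * apply (is_RInt_const 0 (2 * PI) (0 : R)).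
    + unfold minus, plus, opp, scal; simpl; unfold mult; simpl; rewrite Rmult_0_r.
      transitivity (f z * RtoC (2 * PI * kernel_mass m)
        - RtoC (2 * PI * kernel_mass m) * poly_eval (jackson_coef f m) m z)%C; [reflexivity|ring]. }
assert (Hbound : is_RInt (fun t => plus (scal B (kernel (z * circle_point (- t))))
    (scal (B * INR m ^ 2) (Cmod (z - circle_point t) ^ 2 * kernel (z * circle_point (- t)))))
   0 (2 * PI) (plus (scal B (2 * PI * kernel_mass m))
     (scal (B * INR m ^ 2) (2 * PI * (2 * (1 - cos (kernel_angle m)) * kernel_mass m))))).
{ apply @is_RInt_plus; apply @is_RInt_scal.
  - now apply is_RInt_kernel.
  - now apply is_RInt_kernel_moment. }
apply Rmult_le_reg_l with (2 * PI * kernel_mass m); [nra|].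
apply Rle_trans with (norm (RtoC (2 * PI * kernel_mass m)
   * (f z - poly_eval (jackson_coef f m) m z) : C_R_NormedModule)%C).
{ rewrite norm_C_R Cmod_mult Cmod_R Rabs_pos_eq; [lra | nra]. }
eapply Rle_trans.
- apply (norm_RInt_le _ _ 0 (2 * PI) _ _ ltac:(lra)) with (2 := Hint) (3 := Hbound).
  intros t _; rewrite norm_C_R Cmod_mult Cmod_R.
  assert (Hk : 0 <= kernel (z * circle_point (- t))) by apply pow2_ge_0.
  rewrite Rabs_pos_eq //.
  unfold plus, scal; simpl; unfold mult; simpl.
  apply Rle_trans with (kernel (z * circle_point (- t))
     * (B * (1 + (INR m * Cmod (z - circle_point t)) ^ 2))).
  + apply Rmult_le_compat_l; [easy|].
    apply (holder_moment alpha L); try assumption; apply circle_point_on_circle.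
  + right; ring.
- unfold plus, scal; simpl; unfold mult; simpl.
  assert (Hangle : INR m ^ 2 * (2 * (1 - cos (kernel_angle m))) <= PI ^ 2).
  { apply Rle_trans with (INR m ^ 2 * kernel_angle m ^ 2).
    - apply Rmult_le_compat_l; [apply pow2_ge_0 | apply one_minus_cos_le].
    - rewrite -Rpow_mult_distr; apply pow_incr; split.
      + apply Rmult_le_pos; [lra | left; apply kernel_angle_pos].
      + unfold kernel_angle; rewrite S_INR.
        apply Rmult_le_reg_r with (INR m + 1); [lra|].
        replace (INR m * (PI / (INR m + 1)) * (INR m + 1)) with (INR m * PI) by (field; lra).
        nra. }
  fold B; apply Rle_trans with (2 * PI * kernel_mass m * (B * (1 + PI ^ 2))).
  + replace (B * (2 * PI * kernel_mass m) + B * (INR m * (INR m * 1))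
       * (2 * PI * (2 * (1 - cos (kernel_angle m)) * kernel_mass m)))
     with (2 * PI * kernel_mass m * (B * (1 + INR m ^ 2 * (2 * (1 - cos (kernel_angle m))))))
     by ring.
    apply Rmult_le_compat_l; [nra|]; apply Rmult_le_compat_l; lra.
  + right; unfold B; ring.
Qed.

End Jackson.

(** * The disk algebra calculus *)

Lemma norm_minus_triangle {K : AbsRing} {V : NormedModule K} (x y z : V) :
  norm (minus x z) <= norm (minus x y) + norm (minus y z).
Proof. rewrite (minus_trans y); apply norm_triangle. Qed.

Lemma norm_minus_sym {K : AbsRing} {V : NormedModule K} (x y : V) :
  norm (minus x y) = norm (minus y x).
Proof. now rewrite -norm_opp opp_minus. Qed.

(** Coefficients beyond the stated degree are arbitrary, so both sequences are cut off before they
    are subtracted. *)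
Definition poly_sub (a : nat -> C) (N : nat) (b : nat -> C) (M : nat) (k : nat) : C :=
  ((if (k <=? N)%nat then a k else 0) - (if (k <=? M)%nat then b k else 0))%C.

Lemma sum_n_truncate {G : AbelianMonoid} (u : nat -> G) n m : (n <= m)%nat ->
  sum_n (fun k => if (k <=? n)%nat then u k else zero) m = sum_n u n.
Proof.
intros Hnm; rewrite (sum_n_zero_tail _ n m) //.
- apply sum_n_ext_loc; intros k Hk; now rewrite (proj2 (Nat.leb_le k n)).
- intros k Hk; now rewrite (proj2 (Nat.leb_gt k n)).
Qed.

Lemma poly_op_sub {H : Hilbert} a N b M (T : H -> H) x :
  poly_op (poly_sub a N b M) (Nat.max N M) T x = minus (poly_op a N T x) (poly_op b M T x).
Proof.
unfold poly_op, minus.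
rewrite -(sum_n_truncate (fun k => scal (a k) (Nat.iter k T x)) N (Nat.max N M)); [|lia].
rewrite -(sum_n_truncate (fun k => scal (b k) (Nat.iter k T x)) M (Nat.max N M)); [|lia].
rewrite -(scal_opp_one (V := H) (sum_n _ _)) -sum_n_scal_l.
etransitivity; [|apply @sum_n_plus]; apply sum_n_ext; intros k.
rewrite scal_opp_one /poly_sub.
transitivity (minus (scal (if (k <=? N)%nat then a k else RtoC 0) (Nat.iter k T x))
  (scal (if (k <=? M)%nat then b k else RtoC 0) (Nat.iter k T x))).
- exact (scal_minus_distr_r (V := H) (if (k <=? N)%nat then a k else RtoC 0)
    (if (k <=? M)%nat then b k else RtoC 0) (Nat.iter k T x)).
- unfold minus; f_equal; [|f_equal].
  + destruct (k <=? N)%nat; [easy|]; apply (scal_zero_l (V := H)).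
  + destruct (k <=? M)%nat; [easy|]; apply (scal_zero_l (V := H)).
Qed.

Lemma iter_Cmult (z : C) k :
  Nat.iter k (fun w : C_hilbert => z * w : C_hilbert)%C (RtoC 1) = (z ^ k)%C.
Proof. induction k as [|k IH]; [easy|]; simpl; now rewrite IH. Qed.

Lemma poly_op_Cmult a N z :
  poly_op (H := C_hilbert) a N (fun w => z * w)%C (RtoC 1) = poly_eval a N z.
Proof.
induction N as [|N IH]; unfold poly_op, poly_eval in *.
- rewrite !sum_O; reflexivity.
- rewrite !sum_Sn IH iter_Cmult; reflexivity.
Qed.

Lemma poly_eval_sub a N b M z :
  poly_eval (poly_sub a N b M) (Nat.max N M) z = (poly_eval a N z - poly_eval b M z)%C.
Proof. rewrite -!poly_op_Cmult; apply (poly_op_sub (H := C_hilbert)). Qed.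

Lemma Cmult_contraction z : Cmod z <= 1 ->
  contraction (H := C_hilbert) (fun w => z * w)%C.
Proof.
intros Hz; split; [split|].
- intros x y; apply (Cmult_plus_distr_l z x y).
- intros k x; change (z * (k * x) = k * (z * x))%C; ring.
- exists 1; split; [lra|]; intros x; rewrite !norm_C_hilbert Cmod_mult.
  apply Rmult_le_compat_r; [apply Cmod_ge_0 | easy].
- apply opnorm_le; [lra|]; intros x; rewrite !norm_C_hilbert Cmod_mult.
  apply Rmult_le_compat_r; [apply Cmod_ge_0 | easy].
Qed.

(** The explicit rate survives: letting [j] tend to infinity removes [e j] from the bound. *)
Lemma cauchy_limit {K : AbsRing} {V : CompleteNormedModule K} (u : nat -> V) (e : nat -> R) :
  (forall d, 0 < d -> exists n, forall i, (n <= i)%nat -> e i < d) ->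
  (forall i j, norm (minus (u i) (u j)) <= e i + e j) ->
  exists l : V, forall i, norm (minus (u i) l) <= e i.
Proof.
intros He Hu.
assert (Hlim : exists l : V, filterlim u eventually (locally l)).
{ apply (filterlim_locally_cauchy (F := eventually) u); intros eps.
  destruct (He (eps / 2)) as [n Hn]; [apply is_pos_div_2|].
  exists (fun i => (n <= i)%nat); split; [now exists n|].
  intros i j Hi Hj; apply (norm_compat1 (V := V)).
  apply Rle_lt_trans with (1 := Hu j i).
  generalize (Hn i Hi) (Hn j Hj); lra. }
destruct Hlim as [l Hl]; exists l; intros i.
apply le_epsilon; intros d Hd.
destruct (He (d / 2)) as [n Hn]; [lra|].
destruct (proj1 (filterlim_locally_ball_norm (U := V) u l) Hl
  (mkposreal (d / 2) (is_pos_div_2 (mkposreal d Hd)))) as [n' Hn'].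
set (j := Nat.max n n').
apply Rle_trans with (1 := norm_minus_triangle (V := V) (u i) (u j) l).
assert (H1 := Hn' j ltac:(unfold j; lia)).
unfold ball_norm in H1; simpl in H1.
apply Rle_trans with (e i + e j + d / 2).
- apply Rplus_le_compat; [apply Hu | left; exact H1].
- generalize (Hn j ltac:(unfold j; lia)); lra.
Qed.

Lemma poly_op_distance {H : Hilbert} (T : H -> H) b M b' M' d x : contraction T ->
  (forall z, on_circle z -> Cmod (poly_eval b M z - poly_eval b' M' z) <= d) ->
  norm (minus (poly_op b M T x) (poly_op b' M' T x)) <= d * norm x.
Proof.
intros HT Hd; rewrite -poly_op_sub; apply von_neumann; [easy|].
intros t; rewrite poly_eval_sub; apply Hd, circle_point_on_circle.
Qed.

Lemma poly_op_plus {H : Hilbert} (T : H -> H) b M x y : is_linear T ->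
  poly_op b M T (plus x y) = plus (poly_op b M T x) (poly_op b M T y).
Proof.
intros HT; unfold poly_op; etransitivity; [|apply @sum_n_plus].
apply sum_n_ext; intros k; etransitivity; [|apply (scal_distr_l (V := H))].
f_equal; induction k as [|k IH]; [easy|].
simpl; now rewrite IH (linear_plus _ HT).
Qed.

Lemma poly_op_scal {H : Hilbert} (T : H -> H) b M (c : C) x : is_linear T ->
  poly_op b M T (scal c x) = scal c (poly_op b M T x).
Proof.
intros HT; unfold poly_op; rewrite -sum_n_scal_l.
apply sum_n_ext; intros k.
replace (Nat.iter k T (scal c x)) with (scal c (Nat.iter k T x)).
- rewrite !scal_assoc; f_equal; apply Cmult_comm.
- induction k as [|k IH]; [easy|].
  simpl; now rewrite -IH (linear_scal _ HT).
Qed.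

Lemma norm_plus_minus {H : Hilbert} (x y x' y' : H) :
  norm (minus (plus x y) (plus x' y')) <= norm (minus x x') + norm (minus y y').
Proof.
replace (minus (plus x y) (plus x' y')) with (plus (minus x x') (minus y y')).
- apply (norm_triangle (V := H)).
- unfold minus; rewrite (opp_plus (G := H)) -!(plus_assoc (G := H)); f_equal.
  now rewrite !(plus_assoc (G := H)) (plus_comm (G := H) y).
Qed.

(** * Limits of polynomial approximations, scalar and operator-valued *)

Section Limit.
Context (f : C -> C) (a : nat -> nat -> C) (N : nat -> nat) (e : nat -> R).
Hypothesis He : forall d, 0 < d -> exists n, forall i, (n <= i)%nat -> e i < d.
Hypothesis Hcircle : forall j z, on_circle z -> Cmod (f z - poly_eval (a j) (N j) z) <= e j.
Hypothesis Hcoef : forall j k, Cmod (fourier f (Z.of_nat k) - a j k) <= e j.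
Hypothesis Hdegree : forall j k, (N j < k)%nat -> a j k = 0.

Lemma error_ge_0 j : 0 <= e j.
Proof. apply Rle_trans with (2 := Hcoef j 0); apply Cmod_ge_0. Qed.

Lemma circle_cauchy i j z : on_circle z ->
  Cmod (poly_eval (a i) (N i) z - poly_eval (a j) (N j) z) <= e i + e j.
Proof.
intros Hz.
replace (poly_eval (a i) (N i) z - poly_eval (a j) (N j) z)%C
  with ((f z - poly_eval (a j) (N j) z) + - (f z - poly_eval (a i) (N i) z))%C by ring.
apply Rle_trans with (1 := Cmod_triangle _ _).
rewrite Cmod_opp; generalize (Hcircle i z Hz) (Hcircle j z Hz); lra.
Qed.

Lemma limit_unique {H : Hilbert} (u : nat -> H) l l' c c' : 0 <= c -> 0 <= c' ->
  (forall j, norm (minus (u j) l) <= e j * c) ->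
  (forall j, norm (minus (u j) l') <= e j * c') -> l = l'.
Proof.
intros Hc Hc' Hl Hl'.
apply (eq_close (V := H)); intros d.
apply (norm_compat1 (V := H)).
destruct (He (d / (c + c' + 1))) as [n Hn]; [apply Rdiv_lt_0_compat; [apply cond_pos | lra]|].
assert (Hd := cond_pos d); set (q := d / (c + c' + 1)) in *.
assert (Hq : q * (c + c' + 1) = d) by (unfold q; field; lra).
apply Rle_lt_trans with (e n * c' + e n * c).
- apply Rle_trans with (1 := norm_minus_triangle (V := H) l' (u n) l).
  apply Rplus_le_compat; [rewrite (norm_minus_sym (V := H)); apply Hl' | apply Hl].
- generalize (Hn n (le_n n)) (error_ge_0 n); nra.
Qed.

Lemma operator_limit {H : Hilbert} (T : H -> H) : contraction T ->
  exists A : H -> H, is_linear A /\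
    forall j x, norm (minus (poly_op (a j) (N j) T x) (A x)) <= e j * norm x.
Proof.
intros HT; pose proof (proj1 HT) as LT.
(* By von Neumann's inequality the vectors [p_j(T) x] form a Cauchy sequence with rate
   [e j * norm x]; linearity of the limit comes from its uniqueness. *)
assert (Hx : forall x, { l : H |
  forall j, norm (minus (poly_op (a j) (N j) T x) l) <= e j * norm x }).
{ intros x; apply constructive_indefinite_description.
  apply (cauchy_limit (fun j => poly_op (a j) (N j) T x) (fun j => e j * norm x)).
  - intros d Hd; assert (Hn := norm_ge_0 x).
    destruct (He (d / (norm x + 1))) as [n Hn']; [apply Rdiv_lt_0_compat; lra|].
    exists n; intros i Hi.
    apply Rlt_le_trans with (d / (norm x + 1) * (norm x + 1)); [|right; field; lra].
    generalize (Hn' i Hi) (error_ge_0 i); nra.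
  - intros i j; rewrite -Rmult_plus_distr_r; apply poly_op_distance; [easy|].
    intros z Hz; now apply circle_cauchy. }
set (A := fun x => proj1_sig (Hx x)).
assert (HA : forall j x, norm (minus (poly_op (a j) (N j) T x) (A x)) <= e j * norm x)
  by (intros j x; apply (proj2_sig (Hx x))).
exists A; split; [|exact HA]; split.
- intros x y.
  apply (limit_unique (fun j => poly_op (a j) (N j) T (plus x y)) _ _
    (norm (plus x y)) (norm x + norm y)).
  + apply norm_ge_0.
  + apply Rplus_le_le_0_compat; apply norm_ge_0.
  + intros j; apply HA.
  + intros j; rewrite poly_op_plus // Rmult_plus_distr_l.
    apply Rle_trans with (1 := norm_plus_minus _ _ _ _); apply Rplus_le_compat; apply HA.
- intros c x.
  apply (limit_unique (fun j => poly_op (a j) (N j) T (scal c x)) _ _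
    (norm (scal c x)) (norm (scal c x))).
  + apply norm_ge_0.
  + apply norm_ge_0.
  + intros j; apply HA.
  + intros j; rewrite poly_op_scal //.
    apply Rle_trans with (norm (scal c (minus (poly_op (a j) (N j) T x) (A x)))).
    * right; f_equal; symmetry; apply (scal_minus_distr_l (V := H)).
    * rewrite !norm_scal_Cmod -Rmult_assoc (Rmult_comm (e j)) Rmult_assoc.
      apply Rmult_le_compat_l; [apply Cmod_ge_0 | apply HA].
- set (M := sum_n (fun k => Cmod (a 0%nat k)) (N 0%nat)).
  assert (HM : 0 <= M) by (apply sum_n_ge_0; intros k; apply Cmod_ge_0).
  exists (M + e 0%nat + 1); split; [generalize (error_ge_0 0); lra|].
  intros x.
  assert (HP : norm (poly_op (a 0%nat) (N 0%nat) T x) <= M * norm x).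
  { apply von_neumann; [easy|]; intros t.
    apply Rle_trans with (1 := norm_sum_n_m (V := C_NormedModule) _ _ _).
    right; apply sum_n_ext; intros k.
    change (Cmod (a 0%nat k * circle_point t ^ k) = Cmod (a 0%nat k)).
    rewrite Cmod_mult Cmod_pow Cmod_circle_point pow1; ring. }
  assert (Htri : norm (A x) <= norm (poly_op (a 0%nat) (N 0%nat) T x)
     + norm (minus (poly_op (a 0%nat) (N 0%nat) T x) (A x))).
  { rewrite (norm_minus_sym (V := H)).
    apply Rle_trans with (2 := norm_triangle (V := H) _ _).
    right; f_equal; unfold minus.
    now rewrite (plus_comm (G := H) (A x)) (plus_assoc (G := H))
      (plus_opp_r (G := H)) (plus_zero_l (G := H)). }
  generalize (HA 0%nat x) (norm_ge_0 x); lra.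
Qed.

Lemma geometric_sum_le q n : 0 <= q < 1 -> sum_n (fun k => q ^ k) n <= / (1 - q).
Proof.
intros Hq.
assert (Hs : (1 - q) * sum_n (fun k => q ^ k) n = 1 - q ^ S n).
{ induction n as [|n IH]; [rewrite sum_O; simpl; ring|].
  rewrite sum_Sn; unfold plus; simpl AbelianMonoid.plus.
  change ((1 - q) * (sum_n (fun k => q ^ k) n + q ^ S n) = 1 - q ^ S (S n)).
  rewrite Rmult_plus_distr_l IH; simpl; ring. }
apply Rmult_le_reg_l with (1 - q); [lra|].
rewrite Hs Rinv_r; [|lra].
generalize (pow_le q (S n) (proj1 Hq)); lra.
Qed.

(** Compare the Taylor sums with one fixed [p_j]: all coefficients differ by at most [e j], so
    inside the disk the sums differ by at most [e j / (1 - q)], and [p_j] is within [e j] of [G]. *)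
Lemma disk_extension_interior z (G : C) : Cmod z < 1 ->
  (forall j, Cmod (poly_eval (a j) (N j) z - G) <= e j) -> disk_extension f z = G.
Proof.
intros Hz HG; unfold disk_extension; destruct (Rlt_dec (Cmod z) 1); [|easy].
set (q := Cmod z) in *.
assert (Hq : 0 <= q < 1) by (split; [apply Cmod_ge_0 | easy]).
assert (Hq' : 0 < / (1 - q)) by (apply Rinv_0_lt_compat; lra).
assert (HS : is_pseries (K := C_AbsRing) (V := C_NormedModule)
   (fun n => fourier f (Z.of_nat n)) z G).
{ apply (filterlim_locally_ball_norm (K := C_AbsRing) (U := C_NormedModule)); intros eps.
  destruct (He (eps / (/ (1 - q) + 1))) as [j Hj];
    [apply Rdiv_lt_0_compat; [apply cond_pos | lra]|].
  exists (N j); intros n Hn; unfold ball_norm.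
  change (Cmod (sum_n (G := C_AbelianMonoid)
    (fun k => pow_n (K := C_Ring) z k * fourier f (Z.of_nat k))%C n - G) < eps).
  replace (sum_n (G := C_AbelianMonoid)
    (fun k => pow_n (K := C_Ring) z k * fourier f (Z.of_nat k))%C n)
    with (sum_n (G := C_AbelianMonoid)
      (fun k => (fourier f (Z.of_nat k) - a j k) * z ^ k)%C n + poly_eval (a j) (N j) z)%C.
  - apply Rle_lt_trans with (e j * / (1 - q) + e j).
    + match goal with |- Cmod (?u + ?v - G) <= _ =>
        replace (u + v - G)%C with (u + (v - G))%C by ring end.
      apply Rle_trans with (1 := Cmod_triangle _ _); apply Rplus_le_compat; [|apply HG].
      apply Rle_trans with (1 := norm_sum_n_m (V := C_NormedModule) _ _ _).
      apply Rle_trans with (e j * sum_n (fun k => q ^ k) n).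
      * apply Rle_trans with (sum_n (fun k => e j * q ^ k) n);
          [|right; apply (sum_n_mult_l (K := R_Ring))].
        apply sum_n_le_R; intros k _.
        change (Cmod ((fourier f (Z.of_nat k) - a j k) * z ^ k) <= e j * q ^ k).
        rewrite Cmod_mult Cmod_pow; apply Rmult_le_compat_r; [now apply pow_le | apply Hcoef].
      * apply Rmult_le_compat_l; [apply error_ge_0 | now apply geometric_sum_le].
    + apply Rlt_le_trans with (eps / (/ (1 - q) + 1) * (/ (1 - q) + 1)); [|right; field; lra].
      generalize (Hj j (le_n j)); nra.
  - rewrite /poly_eval -(sum_n_zero_tail (G := C_AbelianMonoid) _ (N j) n) //.
    + etransitivity; [symmetry; apply (sum_n_plus (G := C_AbelianMonoid))|].
      apply (sum_n_ext (G := C_AbelianMonoid)); intros k.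
      replace (pow_n (K := C_Ring) z k) with (z ^ k)%C.
      * unfold plus; simpl; Cring.
      * induction k as [|k IH]; [easy|]; simpl; now rewrite IH.
    + intros k Hk; rewrite Hdegree //; apply Cmult_0_l. }
apply (iota_unique (V := C_CompleteNormedModule)); [|exact HS].
intros y Hy; exact (filterlim_locally_unique _ _ _ Hy HS).
Qed.

Lemma disk_extension_approx j z : Cmod z <= 1 ->
  Cmod (poly_eval (a j) (N j) z - disk_extension f z) <= e j.
Proof.
intros Hz; destruct (Rle_lt_or_eq_dec _ _ Hz) as [Hlt | Heq].
(* The limit operator of multiplication by [z], evaluated at 1, supplies the limit of the
   [p_j(z)]. *)
- destruct (operator_limit _ (Cmult_contraction z Hz)) as [A [_ HA]].
  assert (HG : forall i, Cmod (poly_eval (a i) (N i) z - A (RtoC 1)) <= e i).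
  { intros i; rewrite -poly_op_Cmult.
    apply Rle_trans with (1 := HA i (RtoC 1)).
    rewrite norm_C_hilbert Cmod_1; lra. }
  now rewrite (disk_extension_interior z (A (RtoC 1)) Hlt HG).
- unfold disk_extension; destruct (Rlt_dec (Cmod z) 1); [lra|].
  rewrite -Cmod_opp; replace (- (poly_eval (a j) (N j) z - f z))%C
    with (f z - poly_eval (a j) (N j) z)%C by ring.
  now apply Hcircle.
Qed.

Lemma disk_calculus_exists {H : Hilbert} (T : H -> H) : contraction T ->
  exists A, is_disk_calculus (disk_extension f) T A.
Proof.
intros HT; destruct (operator_limit T HT) as [A [LA HA]].
exists A; split; [exact LA|]; intros eps Heps.
exists (eps / 2); split; [lra|]; intros b M Hb.
destruct (He (eps / 4)) as [n Hn]; [lra|].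
specialize (Hn n (le_n n)).
apply opnorm_le; [lra|]; intros x; unfold op_minus.
apply Rle_trans with (1 := norm_minus_triangle (V := H) _ (poly_op (a n) (N n) T x) _).
apply Rle_trans with ((eps / 2 + e n) * norm x + e n * norm x).
- apply Rplus_le_compat; [|apply HA].
  apply poly_op_distance; [easy|]; intros z Hz.
  assert (Hz1 : Cmod z <= 1) by (rewrite Hz; lra).
  replace (poly_eval b M z - poly_eval (a n) (N n) z)%C
    with ((poly_eval b M z - disk_extension f z)
      + - (poly_eval (a n) (N n) z - disk_extension f z))%C by ring.
  apply Rle_trans with (1 := Cmod_triangle _ _); rewrite Cmod_opp.
  generalize (Hb z Hz1) (disk_extension_approx n z Hz1); lra.
- generalize (norm_ge_0 x); nra.
Qed.

(** Whichever operator the choice selects, it is close to [p_n(T)] for large [n]; comparing [p_j(T)]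
    with [p_n(T)] restores the rate [e j]. *)
Lemma apply_op_approx {H : Hilbert} (T : H -> H) : contraction T ->
  forall j x, norm (minus (poly_op (a j) (N j) T x) (apply_op f T x)) <= e j * norm x.
Proof.
intros HT j x; pose proof (proj1 HT) as LT.
destruct (epsilon_spec (inhabits (fun _ : H => zero)) (is_disk_calculus (disk_extension f) T)
  (disk_calculus_exists T HT)) as [LA HA].
change (epsilon _ _) with (apply_op f T) in LA, HA.
assert (Hn := norm_ge_0 x).
apply le_epsilon; intros d Hd.
set (eps := d / (2 * norm x + 1)).
assert (Heps : 0 < eps) by (apply Rdiv_lt_0_compat; lra).
destruct (HA eps Heps) as [delta [Hdelta HA']].
destruct (He (Rmin eps delta)) as [n Hi]; [now apply Rmin_pos|].
specialize (Hi n (le_n n)).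
assert (Hi1 := Rmin_l eps delta); assert (Hi2 := Rmin_r eps delta).
assert (Happ : norm (minus (poly_op (a n) (N n) T x) (apply_op f T x)) <= eps * norm x).
{ apply (opnorm_bound (op_minus (poly_op (a n) (N n) T) (apply_op f T))).
  - intros k y; unfold op_minus; rewrite poly_op_scal // (linear_scal _ LA).
    symmetry; apply (scal_minus_distr_l (V := H)).
  - apply HA'; intros z Hz.
    apply Rle_trans with (1 := disk_extension_approx n z Hz); lra. }
apply Rle_trans with (1 := norm_minus_triangle (V := H) _ (poly_op (a n) (N n) T x) _).
assert (Hd1 := poly_op_distance T (a j) (N j) (a n) (N n) (e j + e n) x HT
  (fun z Hz => circle_cauchy j n z Hz)).
apply Rle_trans with ((e j + e n) * norm x + eps * norm x);
  [exact (Rplus_le_compat _ _ _ _ Hd1 Happ)|].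
apply Rle_trans with (e j * norm x + eps * (2 * norm x + 1)).
{ assert (e n * norm x <= eps * norm x) by (apply Rmult_le_compat_r; lra); nra. }
right; unfold eps; field; lra.
Qed.

End Limit.

(** * Dyadic summation *)

(** A Fourier coefficient of the error is the mean of the error times a unimodular function. *)
Lemma jackson_coef_approx alpha L f m d k : 0 < alpha < 1 -> 0 <= L ->
  (forall z w, on_circle z -> on_circle w ->
    Cmod (f z - f w) <= L * rpow (Cmod (z - w)) alpha) ->
  (forall z, on_circle z -> Cmod (f z - poly_eval (jackson_coef f m) m z) <= d) ->
  Cmod (fourier f (Z.of_nat k) - jackson_coef f m k) <= d.
Proof.
intros Ha HL Hf Hd.
assert (HPI := PI_RGT_0).
assert (Hint := is_RInt_minus (V := C_R_NormedModule) _ _ _ _ _ _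
  (is_RInt_fourier alpha L f Ha HL Hf (Z.of_nat k))
  (is_RInt_poly_fourier (jackson_coef f m) m k (jackson_coef_beyond f m))).
apply Rmult_le_reg_l with (2 * PI); [lra|].
apply Rle_trans with ((2 * PI - 0) * d); [|lra].
apply Rle_trans with (norm (minus (RtoC (2 * PI) * fourier f (Z.of_nat k) : C_R_NormedModule)
   (RtoC (2 * PI) * jackson_coef f m k : C_R_NormedModule))%C).
- rewrite norm_C_R.
  change (2 * PI * Cmod (fourier f (Z.of_nat k) - jackson_coef f m k)
    <= Cmod (RtoC (2 * PI) * fourier f (Z.of_nat k) - RtoC (2 * PI) * jackson_coef f m k)).
  replace (RtoC (2 * PI) * fourier f (Z.of_nat k) - RtoC (2 * PI) * jackson_coef f m k)%C
    with (RtoC (2 * PI) * (fourier f (Z.of_nat k) - jackson_coef f m k))%C by ring.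
  rewrite Cmod_mult Cmod_R Rabs_pos_eq; lra.
- refine (norm_RInt_le_const (V := C_R_NormedModule) _ 0 (2 * PI) _ d _ _ Hint); [lra|].
  intros t _; rewrite norm_C_R.
  change (Cmod (f (circle_point t) * circle_point (- (IZR (Z.of_nat k) * t))
    - poly_eval (jackson_coef f m) m (circle_point t)
      * circle_point (- (IZR (Z.of_nat k) * t))) <= d).
  match goal with |- Cmod (?u * ?v - ?w * ?v) <= _ =>
    replace (u * v - w * v)%C with ((u - w) * v)%C by ring end.
  rewrite Cmod_mult Cmod_circle_point Rmult_1_r; apply Hd, circle_point_on_circle.
Qed.

Lemma holder_norm_finite alpha f : holder alpha f ->
  0 <= real (holder_norm alpha f) /\
  forall z w, on_circle z -> on_circle w ->
    Cmod (f z - f w) <= real (holder_norm alpha f) * rpow (Cmod (z - w)) alpha.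
Proof.
unfold holder; intros Hfin.
assert (Hub : forall q, holder_quotient alpha f q -> Rbar_le q (holder_norm alpha f))
  by (intros q Hq; now apply (proj1 (Lub_Rbar_correct _))).
assert (Hq0 : forall z w, z <> w -> 0 < rpow (Cmod (z - w)) alpha).
{ intros z w Hzw; unfold rpow.
  destruct (Req_EM_T (Cmod (z - w)) 0) as [H0 | H0]; [|apply exp_pos].
  exfalso; apply Hzw; apply Cmod_eq_0 in H0.
  transitivity ((z - w) + w)%C; [ring | rewrite H0; ring]. }
(* The pair 1, -1 shows that there are quotients at all; the supremum of the empty set would be
   minus infinity. *)
assert (Hex : holder_quotient alpha f
   (Cmod (f 1 - f (- (1)))%C / rpow (Cmod (1 - - (1))%C) alpha)).
{ exists (RtoC 1), (- RtoC 1)%C; repeat split.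
  - unfold on_circle; apply Cmod_1.
  - unfold on_circle; rewrite Cmod_opp; apply Cmod_1.
  - intros Heq; injection Heq; lra. }
assert (Hpos : Rbar_le 0 (holder_norm alpha f)).
{ apply Rbar_le_trans with (2 := Hub _ Hex); simpl.
  apply Rmult_le_pos; [apply Cmod_ge_0|left; apply Rinv_0_lt_compat, Hq0].
  intros Heq; injection Heq; lra. }
destruct (holder_norm alpha f) as [l | |]; try easy.
split; [exact Hpos|]; intros z w Hz Hw; simpl.
destruct (Req_EM_T (Cmod (z - w)) 0) as [H0 | H0].
- apply Cmod_eq_0 in H0.
  replace z with w by (transitivity ((z - w) + w)%C; [rewrite H0; ring | ring]).
  replace (f w - f w)%C with (RtoC 0) by ring; rewrite Cmod_0.
  apply Rmult_le_pos; [exact Hpos|]; unfold rpow.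
  destruct (Req_EM_T _ 0); [lra | left; apply exp_pos].
- assert (Hzw : z <> w).
  { intros ->; apply H0; replace (w - w)%C with (RtoC 0) by ring; apply Cmod_0. }
  assert (Hle : Cmod (f z - f w)%C / rpow (Cmod (z - w)%C) alpha <= l)
    by (apply (Hub _); now exists z, w).
  specialize (Hq0 z w Hzw).
  apply Rmult_le_reg_r with (/ rpow (Cmod (z - w)) alpha); [now apply Rinv_0_lt_compat|].
  apply Rle_trans with (1 := Hle); right; field; lra.
Qed.

Lemma dyadic_bracket y : 1 <= y -> exists J, 2 ^ J <= y < 2 ^ S J.
Proof.
intros Hy.
assert (Hn : exists n, y < 2 ^ n).
{ destruct (Pow_x_infinity 2) with (b := y + 1) as [n Hn].
  - rewrite Rabs_pos_eq; lra.
  - exists n; specialize (Hn n (le_n n)).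
    rewrite Rabs_pos_eq in Hn; [lra | apply pow_le; lra]. }
destruct Hn as [n Hn]; induction n as [|n IH]; [simpl in Hn; lra|].
destruct (Rlt_le_dec y (2 ^ n)) as [Hlt | Hle]; [now apply IH | now exists n].
Qed.

Lemma Rpower_pow_INR alpha j :
  Rpower (INR (2 ^ j)) (- alpha) = Rpower 2 (- alpha) ^ j.
Proof.
rewrite pow_INR; change (INR 2) with 2.
rewrite -(Rpower_pow j 2); [|lra].
rewrite -(Rpower_pow j); [|apply exp_pos].
now rewrite !Rpower_mult Rmult_comm.
Qed.

Lemma minus_rearrange {G : AbelianGroup} (u v s t : G) :
  minus u v = plus (minus s t) (minus (minus u s) (minus v t)).
Proof.
unfold minus; rewrite !opp_plus !opp_opp (plus_comm (plus s _)) -!plus_assoc; f_equal.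
rewrite (plus_assoc t) (plus_comm t) -(plus_assoc s t) plus_opp_r plus_zero_r.
now rewrite (plus_comm (opp v)) plus_assoc plus_opp_l plus_zero_l.
Qed.

Section Estimate.
Context (alpha L : R) (f : C -> C).
Hypothesis Halpha : 0 < alpha < 1.
Hypothesis HL : 0 <= L.
Hypothesis Hf : forall z w, on_circle z -> on_circle w ->
  Cmod (f z - f w) <= L * rpow (Cmod (z - w)) alpha.
Hypothesis Hplus : forall n : Z, (n < 0)%Z -> fourier f n = RtoC 0.

Let r := Rpower 2 (- alpha).
Let K := (1 + PI ^ 2) * L.
Let a (j : nat) := jackson_coef f (2 ^ j).

(** [alpha > 0] makes the approximation errors [r^j] decay; [alpha < 1] makes the Bernstein terms
    [(2r)^j] grow, so that their sum is dominated by the last one. *)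
Lemma ratio_bounds : 0 < r < 1 /\ 1 < 2 * r.
Proof.
unfold r; repeat split.
- apply exp_pos.
- rewrite -(Rpower_O 2); [apply Rpower_lt; lra | lra].
- replace (2 * Rpower 2 (- alpha)) with (Rpower 2 (1 + - alpha))
    by (rewrite Rpower_plus Rpower_1; lra).
  apply Rle_lt_trans with (Rpower 2 0); [rewrite Rpower_O; lra | apply Rpower_lt; lra].
Qed.

Lemma dyadic_circle_approx j z : on_circle z ->
  Cmod (f z - poly_eval (a j) (2 ^ j) z) <= K * r ^ j.
Proof.
intros Hz; unfold K, r; rewrite -Rpower_pow_INR.
apply jackson_approx; try assumption.
apply Nat.neq_0_lt_0, Nat.pow_nonzero; lia.
Qed.

Lemma dyadic_error_tends c : 0 < c -> exists n, forall i, (n <= i)%nat -> K * r ^ i < c.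
Proof.
intros Hc; destruct ratio_bounds as [Hr _].
assert (HK : 0 <= K) by (apply Rmult_le_pos; [generalize (pow2_ge_0 PI); lra | exact HL]).
destruct (pow_lt_1_zero r ltac:(rewrite Rabs_pos_eq; lra) (c / (K + 1))) as [n Hn];
  [apply Rdiv_lt_0_compat; lra|].
exists n; intros i Hi; specialize (Hn i Hi).
assert (Hp : 0 < r ^ i) by (apply pow_lt; lra).
rewrite Rabs_pos_eq in Hn; [|lra].
apply Rlt_le_trans with ((K + 1) * (c / (K + 1))); [nra | right; field; lra].
Qed.

Context {H : Hilbert} (T T' : H -> H) (d : R).
Hypothesis HT : contraction T.
Hypothesis HT' : contraction T'.
Hypothesis Hd0 : 0 <= d.
Hypothesis Hd : forall u, norm (minus (T u) (T' u)) <= d * norm u.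

Let D (j : nat) (x : H) : H := minus (poly_op (a j) (2 ^ j) T x) (poly_op (a j) (2 ^ j) T' x).

(** The 4 is 2 from the degree [2^(j+1)] times 2 from [r^(j+1) + r^j <= 2 * r^j]. *)
Lemma dyadic_step j x :
  norm (D (S j) x) <= norm (D j x) + 4 * K * d * (2 * r) ^ j * norm x.
Proof.
destruct ratio_bounds as [Hr _].
assert (HK : 0 <= K) by (apply Rmult_le_pos; [generalize (pow2_ge_0 PI); lra | exact HL]).
assert (Hmax : Nat.max (2 ^ S j) (2 ^ j) = (2 ^ S j)%nat)
  by (apply Nat.max_l, Nat.pow_le_mono_r; lia).
assert (HB : norm (minus (minus (poly_op (a (S j)) (2 ^ S j) T x) (poly_op (a j) (2 ^ j) T x))
    (minus (poly_op (a (S j)) (2 ^ S j) T' x) (poly_op (a j) (2 ^ j) T' x)))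
  <= INR (2 ^ S j) * (K * r ^ S j + K * r ^ j) * d * norm x).
{ rewrite -!poly_op_sub Hmax; apply operator_bernstein; try assumption.
  intros t; rewrite -{2}Hmax poly_eval_sub.
  apply (circle_cauchy f a (fun j => 2 ^ j)%nat (fun j => K * r ^ j) dyadic_circle_approx).
  apply circle_point_on_circle. }
apply Rle_trans with (norm (D j x) + INR (2 ^ S j) * (K * r ^ S j + K * r ^ j) * d * norm x).
- apply Rle_trans with (2 := Rplus_le_compat_l _ _ _ HB).
  apply Rle_trans with (2 := norm_triangle (V := H) _ _).
  right; f_equal; unfold D; apply (minus_rearrange (G := H)).
- apply Rplus_le_compat_l, Rmult_le_compat_r; [apply norm_ge_0|].
  rewrite pow_INR Rpow_mult_distr; change (INR 2) with 2; simpl.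
  assert (H2 : 0 < 2 ^ j) by (apply pow_lt; lra).
  assert (Hrj : 0 < r ^ j) by (apply pow_lt; lra).
  assert (Hprod : 0 <= K * d * (2 ^ j * r ^ j))
    by (apply Rmult_le_pos; [now apply Rmult_le_pos | left; now apply Rmult_lt_0_compat]).
  assert (H1r : 0 <= 1 - r) by lra.
  generalize (Rmult_le_pos _ _ Hprod H1r); lra.
Qed.

Lemma dyadic_difference J x :
  norm (D J x) <= 4 * K * d * ((2 * r) ^ J / (2 * r - 1)) * norm x.
Proof.
destruct ratio_bounds as [Hr H2r].
assert (HK : 0 <= K) by (apply Rmult_le_pos; [generalize (pow2_ge_0 PI); lra | exact HL]).
assert (Hx := norm_ge_0 x).
assert (HKd : 0 <= 4 * K * d) by (apply Rmult_le_pos; [lra | exact Hd0]).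
assert (Hinv : 0 < / (2 * r - 1)) by (apply Rinv_0_lt_compat; lra).
induction J as [|J IH].
- replace (D 0 x) with (zero : H).
  + rewrite norm_zero; apply Rmult_le_pos; [|exact Hx].
    apply Rmult_le_pos; [exact HKd|]; unfold Rdiv; simpl; lra.
  + (* the mean of degree 1 is constant *)
    unfold D, a, poly_op; simpl.
    rewrite !sum_Sn !sum_O jackson_coef_1_1.
    rewrite !(scal_zero_l (V := H)) !plus_zero_r.
    symmetry; apply (minus_eq_zero (G := H)).
- apply Rle_trans with (1 := dyadic_step J x).
  apply Rle_trans with (4 * K * d * ((2 * r) ^ J / (2 * r - 1)) * norm x
    + 4 * K * d * (2 * r) ^ J * norm x); [now apply Rplus_le_compat_r|].
  (* With [q = 2r] the bound reproduces itself exactly: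
     [q^J / (q - 1) + q^J = q^(J+1) / (q - 1)]. *)
  right; simpl; field; lra.
Qed.

Lemma apply_op_difference J x :
  norm (minus (apply_op f T x) (apply_op f T' x))
    <= (2 * K * r ^ J + 4 * K * d * ((2 * r) ^ J / (2 * r - 1))) * norm x.
Proof.
assert (Happ : forall S : H -> H, contraction S ->
  norm (minus (poly_op (a J) (2 ^ J) S x) (apply_op f S x)) <= K * r ^ J * norm x).
{ intros S HS.
  apply (apply_op_approx f a (fun j => 2 ^ j)%nat (fun j => K * r ^ j)); try assumption.
  - exact dyadic_error_tends.
  - exact dyadic_circle_approx.
  - intros j k; apply (jackson_coef_approx alpha L); try assumption.
    intros z Hz; now apply dyadic_circle_approx.
  - intros j k; apply jackson_coef_beyond. }
apply Rle_trans with (1 := norm_minus_triangle (V := H) _ (poly_op (a J) (2 ^ J) T x) _).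
apply Rle_trans with (K * r ^ J * norm x
  + (4 * K * d * ((2 * r) ^ J / (2 * r - 1)) * norm x + K * r ^ J * norm x)).
- apply Rplus_le_compat; [rewrite (norm_minus_sym (V := H)); now apply Happ|].
  apply Rle_trans with (1 := norm_minus_triangle (V := H) _ (poly_op (a J) (2 ^ J) T' x) _).
  apply Rplus_le_compat; [apply dyadic_difference | now apply Happ].
- right; ring.
Qed.

Lemma holder_estimate x : d <= 2 ->
  norm (minus (apply_op f T x) (apply_op f T' x))
    <= (2 + 8 / (2 * r - 1)) * K * rpow d alpha * norm x.
Proof.
intros Hd2.
destruct ratio_bounds as [Hr H2r].
assert (HK : 0 <= K) by (apply Rmult_le_pos; [generalize (pow2_ge_0 PI); lra | exact HL]).
assert (Hx := norm_ge_0 x).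
assert (Hinv : 0 < / (2 * r - 1)) by (apply Rinv_0_lt_compat; lra).
unfold rpow; destruct (Req_EM_T d 0) as [Hz | Hz].
(* For [d = 0] no scale is singled out; only the approximation error remains, and it vanishes as [J]
   grows. *)
- rewrite Rmult_0_r Rmult_0_l; apply le_epsilon; intros c Hc; rewrite Rplus_0_l.
  destruct (dyadic_error_tends (c / (2 * (norm x + 1)))) as [J HJ];
    [apply Rdiv_lt_0_compat; lra|].
  specialize (HJ J (le_n J)).
  apply Rle_trans with (1 := apply_op_difference J x); rewrite Hz.
  apply Rle_trans with (2 * (c / (2 * (norm x + 1))) * (norm x + 1)); [|right; field; lra].
  assert (Hrj : 0 < r ^ J) by (apply pow_lt; lra).
  assert (HKr : 0 <= K * r ^ J) by (apply Rmult_le_pos; [exact HK | lra]).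
  replace (2 * K * r ^ J + _) with (2 * (K * r ^ J)) by (field; lra).
  apply Rmult_le_compat; lra.
- assert (Hd1 : 0 < d) by lra.
  (* [d <= 2] makes [2 / d >= 1]. The lower bracket bounds the Bernstein part by [d * 2^J <= 2], the
     upper one gives [1 / d < 2^J] and hence [r^J <= d^alpha]. *)
  destruct (dyadic_bracket (2 / d)) as [J [HJ1 HJ2]].
  { apply Rmult_le_reg_r with d; [easy|]; unfold Rdiv; rewrite Rmult_assoc Rinv_l; lra. }
  apply Rle_trans with (1 := apply_op_difference J x).
  apply Rmult_le_compat_r; [easy|].
  assert (Hp : 0 < 2 ^ J) by (apply pow_lt; lra).
  assert (Hdp : d * 2 ^ J <= 2).
  { replace 2 with (d * (2 / d)) at 2 by (field; lra); apply Rmult_le_compat_l; lra. }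
  assert (Hdp' : / d <= 2 ^ J).
  { simpl in HJ2; unfold Rdiv in HJ2; lra. }
  assert (HrJ : r ^ J <= Rpower d alpha).
  { unfold r; rewrite -Rpower_pow_INR pow_INR; change (INR 2) with 2.
    replace (Rpower d alpha) with (/ Rpower (/ d) alpha).
    - rewrite Rpower_Ropp; apply Rinv_le_contravar; [apply exp_pos|].
      apply Rle_Rpower_l; [lra | split; [now apply Rinv_0_lt_compat | easy]].
    - rewrite -Rpower_Ropp; unfold Rpower; rewrite ln_Rinv //; f_equal; ring. }
  assert (HrJ0 : 0 < r ^ J) by (apply pow_lt; lra).
  set (p := Rpower d alpha) in *.
  apply Rle_trans with ((2 + 8 / (2 * r - 1)) * K * r ^ J).
  + rewrite Rpow_mult_distr.
    apply Rle_trans with (2 * K * r ^ J + 4 * K * (d * 2 ^ J) * (r ^ J / (2 * r - 1)));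
      [right; field; lra|].
    apply Rle_trans with (2 * K * r ^ J + 4 * K * 2 * (r ^ J / (2 * r - 1)));
      [|right; field; lra].
    apply Rplus_le_compat_l, Rmult_le_compat_r.
    * apply Rmult_le_pos; lra.
    * apply Rmult_le_compat_l; lra.
  + apply Rmult_le_compat_l; [|easy].
    apply Rmult_le_pos; [|easy].
    unfold Rdiv; lra.
Qed.

End Estimate.

Theorem theorem6p1 :
  forall alpha : R, 0 < alpha < 1 ->
  exists c : R, 0 < c /\
    forall f : C -> C, holder_plus alpha f ->
    forall (H : Hilbert) (T R : H -> H), contraction T -> contraction R ->
      Rbar_le (opnorm (op_minus (apply_op f T) (apply_op f R)))
              (Finite (c * real (holder_norm alpha f)
                         * rpow (real (opnorm (op_minus T R))) alpha)).
Proof.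
intros alpha Halpha.
destruct (ratio_bounds alpha Halpha) as [Hr H2r].
set (r := Rpower 2 (- alpha)) in *.
assert (Hinv : 0 < / (2 * r - 1)) by (apply Rinv_0_lt_compat; lra).
assert (Hc : 0 < 2 + 8 / (2 * r - 1)) by (unfold Rdiv; lra).
assert (HP : 0 < 1 + PI ^ 2) by (generalize (pow2_ge_0 PI); lra).
exists ((2 + 8 / (2 * r - 1)) * (1 + PI ^ 2)); split; [now apply Rmult_lt_0_compat|].
intros f [Hholder Hplus] H T R HT HR.
destruct (holder_norm_finite alpha f Hholder) as [HL Hf].
set (L := real (holder_norm alpha f)) in *.
assert (Hhom : forall (k : C) x, op_minus T R (scal k x) = scal k (op_minus T R x)).
{ intros k x; unfold op_minus.
  rewrite (linear_scal _ (proj1 HT)) (linear_scal _ (proj1 HR)).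
  symmetry; apply (scal_minus_distr_l (V := H)). }
(* Two contractions differ by at most 2 in norm, which is the range that [holder_estimate]
   covers. *)
assert (Hle2 : Rbar_le (opnorm (op_minus T R)) 2).
{ apply opnorm_le; [lra|]; intros x; unfold op_minus, minus.
  apply Rle_trans with (1 := norm_triangle (V := H) _ _).
  rewrite norm_opp.
  generalize (contraction_norm T x HT) (contraction_norm R x HR); lra. }
assert (Hge0 := opnorm_ge_0 (op_minus T R)).
assert (Hfin : exists d, opnorm (op_minus T R) = Finite d /\ 0 <= d <= 2).
{ destruct (opnorm (op_minus T R)) as [d | |]; try easy; now exists d. }
destruct Hfin as [d [Hd [Hd0 Hd2]]]; rewrite Hd; simpl.
assert (Hrpow : 0 <= rpow d alpha).
{ unfold rpow; destruct (Req_EM_T d 0); [lra | left; apply exp_pos]. }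
apply opnorm_le.
- repeat apply Rmult_le_pos; lra.
- intros x; unfold op_minus at 1.
  rewrite (Rmult_assoc _ (1 + PI ^ 2) L).
  apply (holder_estimate alpha L); try assumption.
  apply opnorm_bound; [exact Hhom | rewrite Hd; apply Rle_refl].
Qed.
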